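(* For an $s$-stage implicit Runge--Kutta method of stage order $q\ge1$ and classical order $p\ge q+1$, with invertible coefficient matrix $(a_{ij})$, which is algebraically stable ($b_j>0$ for $j=1,\dots,s$ and $(b_ia_{ij}+b_ja_{ji}-b_ib_j)_{i,j=1}^s$ positive semi-definite) and stiffly accurate ($b_j=a_{sj}$ for $j=1,\dots,s$ and $c_s=1$), there exists $\tau_0>0$, depending only on the constants $\mu$ and $\kappa$, such that for $\tau\le\tau_0$ and $t_n=n\tau\le T$ the error $e_n$ is bounded by $$|e_n|_{M_n}^2+\tau\sum_{k=1}^n|e_k|_{A_k}^2\le C\Big\{|e_0|_{M_0}^2+\tau\sum_{k=0}^{n-1}\sum_{i=1}^s\|M_{ki}r_{ki}\|_{*,t_{ki}}^2+\tau\sum_{k=1}^n\big|\delta_k/\tau\big|_{M_k^{-1}}^2+\tau\sum_{k=0}^{n-1}\sum_{i=1}^s\Big(|M_{ki}^{-1}\Delta_{ki}|_{M_{ki}}^2+|M_{ki}^{-1}\Delta_{ki}|_{A_{ki}}^2\Big)\Big\},$$ where $\|\omega\|_{*,t}^2=\omega^T(A(t)+M(t))^{-1}\omega$ and $t_{ki}=t_k+c_i\tau$. The constant $C$ is independent of $h$, $\tau$ and $n$, but depends on $\mu$, $\kappa$, $T$ and on the norm of the difference of the velocities.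
   Context: Surface. $\Gamma(t)\subset\mathbb R^{m+1}$, $t\in[0,T]$, is a closed (compact, oriented, without boundary) smooth hypersurface evolving smoothly: there is a smooth map $\Phi:\Gamma(0)\times[0,T]\to\mathbb R^{m+1}$ with $\Phi(\cdot,0)=\mathrm{Id}$, $\Phi(\cdot,t):\Gamma(0)\to\Gamma(t)$ a diffeomorphism, $\partial_t\Phi(\cdot,t)=v(\Phi(\cdot,t),t)$ ($v$: material velocity). The ALE map $\mathcal A$ is another such smooth map, with ALE velocity $w$; then $v-w$ is tangential. ALE ESFEM. $\Gamma_h(t)$ is a triangulated surface with nodes $a_j(t)=\mathcal A(a_j(0),t)\in\Gamma(t)$, $j=1,\dots,N$, whose simplices form an admissible triangulation (conforming, with inradii bounded below by $ch$, $c$ independent of $h,t$) with maximal diameter $h$. $\chi_j(\cdot,t)$ is the nodal basis of continuous piecewise linear functions on $\Gamma_h(t)$, $\chi_j(a_i(t),t)=\delta_{ij}$; $V_h=\sum_jv(a_j(t),t)\chi_j$, $W_h=\sum_jw(a_j(t),t)\chi_j$; $\nabla_{\Gamma_h}$ is the piecewise tangential gradient. Set $M(t)_{kj}=\int_{\Gamma_h(t)}\chi_j\chi_k$, $A(t)_{kj}=\int_{\Gamma_h(t)}\nabla_{\Gamma_h}\chi_j\cdot\nabla_{\Gamma_h}\chi_k$, $B(t)_{kj}=\int_{\Gamma_h(t)}\chi_j(W_h-V_h)\cdot\nabla_{\Gamma_h}\chi_k$. For a symmetric positive semi-definite matrix $K$, $|z|_K^2=z^TKz$. Constants $\mu,\kappa$.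 These are constants independent of $h$ such that for all $y,z\in\mathbb R^N$, $s,t\in[0,T]$: $z^T(M(s)-M(t))y\le(e^{\mu|s-t|}-1)|z|_{M(t)}|y|_{M(t)}$, $z^T(M^{-1}(s)-M^{-1}(t))y\le(e^{\mu|s-t|}-1)|z|_{M^{-1}(t)}|y|_{M^{-1}(t)}$, $z^T(A(s)-A(t))y\le(e^{\kappa|s-t|}-1)|z|_{A(t)}|y|_{A(t)}$. Runge--Kutta method for $\frac{d}{dt}(M\alpha)+A\alpha+B\alpha=0$, $\alpha(0)=\alpha_0$ (step size $\tau$, $t_n=n\tau$, $M_n=M(t_n)$, $A_n=A(t_n)$, $M_{ni}=M(t_n+c_i\tau)$, similarly $A_{ni},B_{ni}$): $M_{ni}\alpha_{ni}=M_n\alpha_n+\tau\sum_{j=1}^sa_{ij}\dot\alpha_{nj}$, $M_{n+1}\alpha_{n+1}=M_n\alpha_n+\tau\sum_{i=1}^sb_i\dot\alpha_{ni}$, with $0=\dot\alpha_{ni}+B_{ni}\alpha_{ni}+A_{ni}\alpha_{ni}$, $i=1,\dots,s$. Perturbed problem and errors. Let $\tilde\alpha$ solve $\frac{d}{dt}(M\tilde\alpha)+A\tilde\alpha+B\tilde\alpha=M r$, $\tilde\alpha(0)=\tilde\alpha_0$, for a given $r(t)\in\mathbb R^N$, and let $\dot{\tilde\alpha}=\frac{d}{dt}(M\tilde\alpha)$, $r_{ni}=r(t_n+c_i\tau)$. The defects $\Delta_{ni}$, $\delta_{n+1}$ are defined by inserting $\tilde\alpha$ into the method: $M_{ni}\tilde\alpha(t_n+c_i\tau)=M_n\tilde\alpha(t_n)+\tau\sum_ja_{ij}\dot{\tilde\alpha}(t_n+c_j\tau)+\Delta_{ni}$,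 $M_{n+1}\tilde\alpha(t_{n+1})=M_n\tilde\alpha(t_n)+\tau\sum_ib_i\dot{\tilde\alpha}(t_n+c_i\tau)+\delta_{n+1}$. The error is $e_n=\alpha_n-\tilde\alpha(t_n)$. ''Norm of the difference of the velocities'' refers to the norm of $w-v$ (equivalently the maximum norm of $W_h-V_h$).
   Formalization: τ₀ may also depend on a bound, fixed beforehand, for |w−v|, not only on μ and κ: with τ₀(μ,κ) alone the claim fails, as large velocity differences can make the stage system singular for arbitrarily small τ. Times t_k+c_iτ are assumed to lie in [0,T]. *)

(* Defs.v *)
From HB Require Import structures.
From mathcomp Require Import all_boot all_order all_algebra.
From mathcomp Require Import all_classical all_reals all_analysis.

Set Implicit Arguments.
Unset Strict Implicit.
Unset Printing Implicit Defensive.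

Import Order.TTheory GRing.Theory Num.Theory.
Import numFieldNormedType.Exports.

Local Open Scope classical_set_scope.
Local Open Scope ring_scope.

(* The library norm `|x| on row vectors is the maximum norm; distances,
   diameters and inradii below use the Euclidean norm [enorm]. *)
Definition dotv (R : realType) (d : nat) (x y : 'rV[R]_d) : R :=
  \sum_i x 0 i * y 0 i.

Definition enorm (R : realType) (d : nat) (x : 'rV[R]_d) : R :=
  Num.sqrt (dotv x x).

(* z^T K y, |z|_K^2 and |z|_K. *)
Definition bform (R : realType) (N : nat) (K : 'M[R]_N) (z y : 'cV[R]_N) : R :=
  (z^T *m K *m y) 0 0.

Definition qform (R : realType) (N : nat) (K : 'M[R]_N) (z : 'cV[R]_N) : R :=
  bform K z z.

Definition mnorm (R : realType) (N : nat) (K : 'M[R]_N) (z : 'cV[R]_N) : R :=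
  Num.sqrt (qform K z).

(* Derivative relative to [0, T]: two-sided inside, one-sided at 0 and T. *)
Definition deriv_on (R : realType) (W : normedModType R) (T : R)
    (f : R -> W) (t : R) (l : W) : Prop :=
  (fun u => (u - t)^-1 *: (f u - f t)) @ within `[0, T] (dnbhs t) --> l.

Fixpoint Ck (R : realType) (V W : normedModType R) (k : nat) (f : V -> W)
    : Prop :=
  match k with
  | 0 => continuous f
  | k'.+1 => (forall x, differentiable f x) /\ forall u, Ck k' ('D_u f)
  end.

Definition smooth (R : realType) (V W : normedModType R) (f : V -> W) : Prop :=
  forall k, Ck k f.

(* Only used for closed S (a closed submanifold, or its product with [0, T]),
   where extendability to the ambient space is smoothness on S. *)
Definition smooth_on (R : realType) (V W : normedModType R) (S : set V)
    (f : V -> W) : Prop :=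
  exists2 F : V -> W, smooth F & {in S, F =1 f}.

(* Locally S is the zero set of a smooth phi whose gradient is a positive
   multiple of the unit normal nu; nu gives the orientation.  A level set of
   this kind has no boundary. *)
Definition closed_hypersurface (R : realType) (d : nat) (S : set 'rV[R]_d)
    : Prop :=
  [/\ S !=set0, compact S &
      exists2 nu : 'rV[R]_d -> 'rV[R]_d, smooth_on S nu &
        forall p, S p -> enorm (nu p) = 1 /\
          exists (phi : 'rV[R]_d -> R) (g : R),
            [/\ 0 < g, smooth phi,
                \forall x \near p, S x <-> phi x = 0 &
                forall u, 'D_u phi p = g * dotv (nu p) u]].

Definition diffeo_on (R : realType) (d : nat) (S S' : set 'rV[R]_d)
    (f : 'rV[R]_d -> 'rV[R]_d) : Prop :=
  [/\ set_bij S S' f, smooth_on S f &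
      exists2 g : 'rV[R]_d -> 'rV[R]_d, smooth_on S' g & {in S, cancel f g}].

(* Phi is a smooth parametrisation of the surfaces Gamma t over Gamma 0, with
   velocity v.  The material flow and the ALE map are both of this kind. *)
Definition evolution (R : realType) (d : nat) (T : R)
    (Gamma : R -> set 'rV[R]_d) (Phi : 'rV[R]_d * R -> 'rV[R]_d)
    (v : 'rV[R]_d -> R -> 'rV[R]_d) : Prop :=
  [/\ smooth_on (Gamma 0 `*` `[0, T]) Phi,
      forall x, Gamma 0 x -> Phi (x, 0) = x,
      forall t : R, 0 <= t <= T ->
        diffeo_on (Gamma 0) (Gamma t) (fun x => Phi (x, t)) &
      forall x t, Gamma 0 x -> 0 <= t <= T ->
        deriv_on T (fun u => Phi (x, u)) t (v (Phi (x, t)) t)].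

(* The (time-independent) connectivity of N nodes: [vert E i] is the i-th
   vertex of the E-th m-dimensional simplex. *)
Record connectivity (m N : nat) := Connectivity {
  nsimp : nat;
  vert : 'I_nsimp -> 'I_m.+1 -> 'I_N }.

Definition vset (m N : nat) (X : connectivity m N) (E : 'I_(nsimp X))
    : {set 'I_N} := [set vert E i | i in 'I_m.+1].

Definition affine_hull (R : realType) (d N : nat) (a : 'I_N -> 'rV[R]_d)
    (J : {set 'I_N}) : set 'rV[R]_d :=
  [set x | exists l : 'I_N -> R,
     [/\ forall j, j \notin J -> l j = 0, \sum_j l j = 1 &
         x = \sum_j l j *: a j]].

Definition convex_hull (R : realType) (d N : nat) (a : 'I_N -> 'rV[R]_d)
    (J : {set 'I_N}) : set 'rV[R]_d :=
  [set x | exists l : 'I_N -> R,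
     [/\ forall j, 0 <= l j, forall j, j \notin J -> l j = 0,
         \sum_j l j = 1 & x = \sum_j l j *: a j]].

Definition diameter (R : realType) (d : nat) (S : set 'rV[R]_d) : R :=
  sup [set enorm (x - y) | x in S & y in S].

Definition inradius (R : realType) (d N : nat) (a : 'I_N -> 'rV[R]_d)
    (J : {set 'I_N}) : R :=
  sup [set r | 0 <= r /\ exists2 x, affine_hull a J x &
         forall y, affine_hull a J y -> enorm (y - x) <= r ->
           convex_hull a J y].

(* Jacobian (one edge vector per row) of the affine map [elt_map] from the
   reference simplex {xi >= 0, sum xi <= 1} onto the simplex with vertices p. *)
Definition edges (R : realType) (m d : nat) (p : 'I_m.+1 -> 'rV[R]_d)
    : 'M[R]_(m, d) :=
  \matrix_(i < m) (p (lift ord0 i) - p ord0).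

Definition elt_map (R : realType) (m d : nat) (p : 'I_m.+1 -> 'rV[R]_d)
    (xi : 'rV[R]_m) : 'rV[R]_d :=
  p ord0 + xi *m edges p.

Definition gram (R : realType) (m d : nat) (p : 'I_m.+1 -> 'rV[R]_d)
    : 'M[R]_m := edges p *m (edges p)^T.

(* Lebesgue integral over the open simplex {xi > 0, sum xi < r} of R^m, as an
   iterated integral.  Working on the open simplex discards a null set only,
   and keeps away from faces, where piecewise linear functions have kinks. *)
Fixpoint ref_integral (R : realType) (m : nat) (r : R)
    : ('rV[R]_m -> R) -> R :=
  match m with
  | 0 => fun f => f 0
  | m'.+1 => fun f =>
      \int[lebesgue_measure]_(x in `]0, r[)
        ref_integral (r - x) (fun y : 'rV[R]_m' => f (row_mx (x%:M : 'rV[R]_1) y))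
  end.

(* Integral over the simplex with vertices p, with respect to m-dimensional
   surface measure, of the function whose pull-back by [elt_map p] is f. *)
Definition elt_integral (R : realType) (m d : nat) (p : 'I_m.+1 -> 'rV[R]_d)
    (f : 'rV[R]_m -> R) : R :=
  Num.sqrt (\det (gram p)) * ref_integral 1 f.

(* Tangential gradient of u at the point [elt_map p xi] of the simplex:
   sum_ij g^ij (d_j (u o F)) (d_i F), with F = elt_map p and (g^ij) the inverse
   of the metric tensor. *)
Definition tgrad (R : realType) (m d : nat) (p : 'I_m.+1 -> 'rV[R]_d)
    (u : 'rV[R]_d -> R) (xi : 'rV[R]_m) : 'rV[R]_d :=
  (\row_(i < m) 'D_(delta_mx 0 i) (u \o elt_map p) xi)
    *m invmx (gram p) *m edges p.

Section ESFEM.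
Context (R : realType) (m N : nat) (X : connectivity m N).
Local Notation vec := 'rV[R]_m.+1.

Definition elt (a : 'I_N -> vec) (E : 'I_(nsimp X)) : 'I_m.+1 -> vec :=
  fun i => a (vert E i).

Definition elt_set (a : 'I_N -> vec) (E : 'I_(nsimp X)) : set vec :=
  convex_hull a (vset E).

Definition Gamma_h (a : 'I_N -> vec) : set vec :=
  [set x | exists E : 'I_(nsimp X), elt_set a E x].

Definition mesh_size (T : R) (a : R -> 'I_N -> vec) : R :=
  sup [set diameter (elt_set (a t) E) | t in `[0, T] & E in setT].

(* The first three clauses say that the simplices form a closed triangulated
   surface: no unused node, no repeated simplex, and every facet shared by
   exactly two simplices.  Then, at each time: nondegeneracy, conformity (two
   simplices meet along their common face), and the inradius bound. *)
Definition admissible (T c h : R) (a : R -> 'I_N -> vec) : Prop :=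
  [/\ forall j, exists E : 'I_(nsimp X), j \in vset E,
      injective (@vset m N X),
      forall (E : 'I_(nsimp X)) (i : 'I_m.+1),
        #|[set E' : 'I_(nsimp X) | vset E :\ vert E i \subset vset E']| = 2%N,
      h = mesh_size T a &
      forall t : R, 0 <= t <= T ->
        [/\ forall E, row_free (edges (elt (a t) E)),
            forall E E', elt_set (a t) E `&` elt_set (a t) E'
                         = convex_hull (a t) (vset E :&: vset E') &
            forall E : 'I_(nsimp X), c * h <= inradius (a t) (vset E)]].

Definition nodal_basis (T : R) (a : R -> 'I_N -> vec)
    (chi : 'I_N -> R -> vec -> R) : Prop :=
  forall t : R, 0 <= t <= T -> forall j,
    [/\ {within Gamma_h (a t), continuous (chi j t)},
        forall E, exists (g : vec) (b : R),
          forall x, elt_set (a t) E x -> chi j t x = dotv g x + b &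
        forall i, chi j t (a t i) = (j == i)%:R].

Definition interp (chi : 'I_N -> R -> vec -> R) (a : R -> 'I_N -> vec)
    (v : vec -> R -> vec) (t : R) (x : vec) : vec :=
  \sum_j chi j t x *: v (a t j) t.

Definition mass (a : R -> 'I_N -> vec) (chi : 'I_N -> R -> vec -> R) (t : R)
    : 'M[R]_N :=
  \matrix_(k, j) \sum_(E < nsimp X)
    elt_integral (elt (a t) E) (fun xi =>
      let x := elt_map (elt (a t) E) xi in chi j t x * chi k t x).

Definition stiffness (a : R -> 'I_N -> vec) (chi : 'I_N -> R -> vec -> R)
    (t : R) : 'M[R]_N :=
  \matrix_(k, j) \sum_(E < nsimp X)
    elt_integral (elt (a t) E) (fun xi =>
      dotv (tgrad (elt (a t) E) (chi j t) xi)
           (tgrad (elt (a t) E) (chi k t) xi)).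

Definition advection (a : R -> 'I_N -> vec) (chi : 'I_N -> R -> vec -> R)
    (v w : vec -> R -> vec) (t : R) : 'M[R]_N :=
  \matrix_(k, j) \sum_(E < nsimp X)
    elt_integral (elt (a t) E) (fun xi =>
      let x := elt_map (elt (a t) E) xi in
      chi j t x * dotv (interp chi a w t x - interp chi a v t x)
                       (tgrad (elt (a t) E) (chi k t) xi)).

End ESFEM.

Definition variation_bound (R : realType) (N : nat) (T mu : R)
    (K : R -> 'M[R]_N) : Prop :=
  forall (y z : 'cV[R]_N) (s t : R), 0 <= s <= T -> 0 <= t <= T ->
    bform (K s - K t) z y
      <= (expR (mu * `|s - t|) - 1) * mnorm (K t) z * mnorm (K t) y.

(* A Runge-Kutta method with s.+1 stages (so that there is a last stage). *)
Record rk_method (R : realType) (s : nat) := RKMethod {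
  rk_a : 'M[R]_s.+1;
  rk_b : 'I_s.+1 -> R;
  rk_c : 'I_s.+1 -> R }.

Definition stage_order (R : realType) (s : nat) (rk : rk_method R s) (q : nat)
    : Prop :=
  forall k, (1 <= k <= q)%N ->
    (forall i, \sum_j rk_a rk i j * rk_c rk j ^+ k.-1 = rk_c rk i ^+ k / k%:R) /\
    \sum_j rk_b rk j * rk_c rk j ^+ k.-1 = k%:R^-1.

(* Local error O(tau^(p+1)) for every smooth system y' = f(t, y).  For an
   implicit method the stages are the solution branch Y tau of the stage
   equations that tends to the initial value as tau -> 0+. *)
Definition classical_order (R : realType) (s : nat) (rk : rk_method R s)
    (p : nat) : Prop :=
  forall (d : nat) (f : R * 'rV[R]_d -> 'rV[R]_d) (t0 : R) (y : R -> 'rV[R]_d)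
         (Y : R -> 'I_s.+1 -> 'rV[R]_d),
    smooth f ->
    (\forall t \near t0, is_derive (t : R) (1 : R) y (f (t, y t))) ->
    (forall i, Y tau i @[tau --> 0^'+] --> y t0) ->
    (\forall tau \near 0^'+, forall i,
       Y tau i = y t0 + tau *: \sum_j rk_a rk i j *:
                                 f (t0 + rk_c rk j * tau, Y tau j)) ->
    exists K : R, \forall tau \near 0^'+,
      `|y t0 + tau *: (\sum_i rk_b rk i *: f (t0 + rk_c rk i * tau, Y tau i))
        - y (t0 + tau)| <= K * tau ^+ p.+1.

Definition algebraically_stable (R : realType) (s : nat) (rk : rk_method R s)
    : Prop :=
  (forall j, 0 < rk_b rk j) /\
  (forall z : 'cV[R]_s.+1,
     0 <= qform (\matrix_(i, j) (rk_b rk i * rk_a rk i j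
                   + rk_b rk j * rk_a rk j i - rk_b rk i * rk_b rk j)) z).

Definition stiffly_accurate (R : realType) (s : nat) (rk : rk_method R s)
    : Prop :=
  (forall j, rk_b rk j = rk_a rk ord_max j) /\ rk_c rk ord_max = 1.

Section Scheme.
Context (R : realType) (s N : nat) (rk : rk_method R s) (tau : R).
Context (M A B : R -> 'M[R]_N).

Definition tn (k : nat) : R := k%:R * tau.
Definition tst (k : nat) (i : 'I_s.+1) : R := tn k + rk_c rk i * tau.

(* n steps of the method: [al k] = alpha_k, [st k i] = alpha_ki and
   [dst k i] = dot alpha_ki. *)
Definition rk_solution (n : nat) (al : nat -> 'cV[R]_N)
    (st dst : nat -> 'I_s.+1 -> 'cV[R]_N) : Prop :=
  forall k, (k < n)%N ->
    [/\ forall i, M (tst k i) *m st k i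
          = M (tn k) *m al k + tau *: \sum_j rk_a rk i j *: dst k j,
        M (tn k.+1) *m al k.+1
          = M (tn k) *m al k + tau *: \sum_i rk_b rk i *: dst k i &
        forall i, 0 = dst k i + B (tst k i) *m st k i + A (tst k i) *m st k i].

(* [dta] is d/dt (M ta). *)
Definition perturbed_solution (T : R) (r ta dta : R -> 'cV[R]_N) : Prop :=
  forall t : R, 0 <= t <= T ->
    deriv_on T (fun u => M u *m ta u) t (dta t) /\
    dta t + A t *m ta t + B t *m ta t = M t *m r t.

Definition stage_defect (ta dta : R -> 'cV[R]_N) (k : nat) (i : 'I_s.+1)
    : 'cV[R]_N :=
  M (tst k i) *m ta (tst k i)
    - (M (tn k) *m ta (tn k) + tau *: \sum_j rk_a rk i j *: dta (tst k j)).

(* delta_k for k >= 1, the defect of the step from t_(k-1) to t_k. *)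
Definition step_defect (ta dta : R -> 'cV[R]_N) (k : nat) : 'cV[R]_N :=
  M (tn k) *m ta (tn k)
    - (M (tn k.-1) *m ta (tn k.-1)
       + tau *: \sum_i rk_b rk i *: dta (tst k.-1 i)).

End Scheme.

(* Main.v *)
(* Relative to a fixed time, the error equation is measured in the inner product
   of M(t_k)^-1: algebraic stability gives an energy inequality in which, after
   testing with the stage errors E_ki, the stiffness matrix contributes
   -|E_ki|_A^2, the advection term is absorbed by Young's inequality, and the
   change of M^-1 over one step costs a factor O(tau), because tau times the
   stage derivatives is a combination of stage values (invertibility of the
   coefficient matrix).  The stage errors in the M-norm are controlled by testing
   the stage equations with E_ki.  Stiff accuracy forces delta_(k+1) = Delta_ks
   and e_(k+1) = E_ks, so |E_ks|_A is the quantity summed on the left-hand side,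
   and a discrete Gronwall inequality concludes.

   The matrices enter only through: M symmetric positive definite, A symmetric
   positive semi-definite, z^T B y <= eps |z|_A^2 + Lambda^2/(4 eps) |y|_M^2, and
   positivity of sum_ij G_ij Y_i^T M Y_j for G positive semi-definite.  On the open
   reference simplex the nodal basis functions are the barycentric coordinates,
   so all integrands are polynomials; this settles integrability, linearity and
   definiteness of the iterated integral. *)
Require Import Defs.
From HB Require Import structures.
From mathcomp Require Import all_boot all_order all_algebra.
From mathcomp Require Import all_classical all_reals all_analysis.
From mathcomp Require Import ring lra.

Set Implicit Arguments.
Unset Strict Implicit.
Unset Printing Implicit Defensive.

Import Order.TTheory GRing.Theory Num.Theory.
Import numFieldNormedType.Exports.

Local Open Scope classical_set_scope.
Local Open Scope ring_scope.

(** * Integrals of polynomials over an interval *)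

Lemma poly_antiderivative (R : realType) (p : {poly R}) :
  exists P : {poly R}, P^`() = p.
Proof.
(* At index 0 the quotient by [0%:R] is 0 by convention, and differentiation discards that
   coefficient. *)
exists (\poly_(i < (size p).+1) (p`_i.-1 / i%:R)).
apply/polyP => i; rewrite coef_deriv coef_poly ltnS.
case: ltnP => hi /=; last by rewrite mul0rn nth_default.
by rewrite -[LHS]mulr_natr divfK// pnatr_eq0.
Qed.

Lemma horner_integrable (R : realType) (p : {poly R}) (a b : R) :
  (@lebesgue_measure R).-integrable `]a, b[ (EFin \o horner p).
Proof.
have cp : {within `[a, b], continuous (horner p)}.
  by apply: continuous_subspaceT => x; exact: continuous_horner.
have := continuous_compact_integrable (@segment_compact _ a b) cp.
by apply: integrableS => //; exact: subset_itv_oo_cc.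
Qed.

Lemma Rintegral_horner (R : realType) (p P : {poly R}) (a b : R) :
  P^`() = p -> a <= b ->
  \int[lebesgue_measure]_(x in `]a, b[) p.[x] = P.[b] - P.[a].
Proof.
move=> Pp; rewrite le_eqVlt => /orP[/eqP ->|ab].
  by rewrite set_itv_ge ?bnd_simp ?ltxx// Rintegral_set0 subrr.
rewrite /Rintegral -(@integral_itv_bndoo _ _ _ _ true false); last first.
  by have /integrableP[] := horner_integrable p a b.
rewrite (@continuous_FTC2 _ (horner p) (horner P))//.
- by apply: continuous_subspaceT => x; exact: continuous_horner.
- split => [x _||]; first exact: derivable_horner.
    by apply: cvg_at_right_filter; exact: continuous_horner.
  by apply: cvg_at_left_filter; exact: continuous_horner.
- by move=> x _; rewrite -Pp derivE.
Qed.

Lemma RintegralD_horner (R : realType) (p q : {poly R}) (a b : R) :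
  \int[lebesgue_measure]_(x in `]a, b[) (p + q).[x]
  = \int[lebesgue_measure]_(x in `]a, b[) p.[x]
    + \int[lebesgue_measure]_(x in `]a, b[) q.[x].
Proof.
rewrite -RintegralD//; try exact: horner_integrable.
by apply: eq_Rintegral => x _; rewrite hornerD.
Qed.

Lemma RintegralM_horner (R : realType) (c : R) (q : {poly R}) (a b : R) :
  \int[lebesgue_measure]_(x in `]a, b[) (c *: q).[x]
  = c * \int[lebesgue_measure]_(x in `]a, b[) q.[x].
Proof.
rewrite -RintegralZl//; try exact: horner_integrable.
by apply: eq_Rintegral => x _; rewrite hornerZ.
Qed.

(** An antiderivative [P] is nondecreasing on the interval with equal values at both ends, hence
    constant there; [P - P(0)] then has too many roots to be nonzero. *)
Lemma Rintegral_horner_eq0 (R : realType) (p : {poly R}) (r : R) : 0 < r ->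
  (forall x, 0 < x < r -> 0 <= p.[x]) ->
  \int[lebesgue_measure]_(x in `]0, r[) p.[x] = 0 -> p = 0.
Proof.
move=> r0 p0; have [P Pp] := poly_antiderivative p.
rewrite (Rintegral_horner Pp (ltW r0)) => Pr.
have PE x : 0 < x < r -> P.[x] = P.[0].
  move=> /andP[x0 xr].
  have h1 : 0 <= P.[x] - P.[0].
    rewrite -(Rintegral_horner Pp (ltW x0)); apply: Rintegral_ge0 => y /=.
    rewrite in_itv/= => /andP[y0 yx]; apply: p0; rewrite y0/=.
    exact: lt_trans xr.
  have h2 : 0 <= P.[r] - P.[x].
    rewrite -(Rintegral_horner Pp (ltW xr)); apply: Rintegral_ge0 => y /=.
    rewrite in_itv/= => /andP[y0 yx]; apply: p0; rewrite yx andbT.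
    exact: lt_trans y0.
  lra.
rewrite -Pp -[P](subrK (P.[0])%:P) derivD derivC addr0.
set Q := P - _; suff -> : Q = 0 by rewrite deriv0.
(* The points [r / (k + 2)] are distinct and interior, and there are [size Q] of them, one more than
   a nonzero [Q] could have as roots. *)
pose s := [seq r / k.+2%:R | k <- iota 0 (size Q)].
apply: (@roots_geq_poly_eq0 _ _ s); last by rewrite size_map size_iota.
- apply/allP => _ /mapP[k _ ->]; rewrite /root /Q !hornerE PE ?subrr//.
  by rewrite divr_gt0//= ltr_pdivrMr// ltr_pMr// ltr1n.
- rewrite map_inj_uniq ?iota_uniq// => i j.
  move=> /(mulfI (lt0r_neq0 r0))/invr_inj/eqP; rewrite eqr_nat !eqSS.
  by move/eqP.
Qed.

(** Induction on [q]: at [r - x], the polynomial [q X + c] becomes [r q(r - x) - x q(r - x) + c],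
    and the factor [x] is absorbed into [p], which is therefore general. Such convolutions arise
    because the slice at [x] of a simplex of size [r] has size [r - x]. *)
Lemma Rintegral_convolution (R : realType) (q p : {poly R}) :
  exists Z : {poly R}, forall r, 0 <= r ->
    \int[lebesgue_measure]_(x in `]0, r[) (p * (q \Po (r%:P - 'X))).[x]
    = Z.[r].
Proof.
elim/poly_ind: q p => [|q c IH] p.
  exists 0 => r r0; rewrite horner0 comp_poly0 mulr0.
  by have := RintegralM_horner 0 0 0 r; rewrite scale0r mul0r.
have [Z1 HZ1] := IH p; have [Z2 HZ2] := IH (p * 'X).
have [P Pp] := poly_antiderivative p.
exists ('X * Z1 - Z2 + c *: (P - (P.[0])%:P)) => r r0.
have -> : p * ((q * 'X + c%:P) \Po (r%:P - 'X)) =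
    (r *: (p * (q \Po (r%:P - 'X))) + (-1) *: (p * 'X * (q \Po (r%:P - 'X))))
    + c *: p.
  rewrite comp_polyD comp_polyM comp_polyX comp_polyC -!mul_polyC.
  rewrite polyCN; ring.
rewrite !(RintegralD_horner, RintegralM_horner) HZ1// HZ2//.
rewrite (Rintegral_horner Pp r0) !hornerE; ring.
Qed.

(** * Integrals of polynomial functions over the reference simplex *)

(** A predicate on functions suffices: only closure under ring operations and restriction to slices
    is used. *)
Inductive polyfun (R : realType) (m : nat) : ('rV[R]_m -> R) -> Prop :=
| polyfun_cst c : polyfun (fun=> c)
| polyfun_coord i : polyfun (fun x => x 0 i)
| polyfunD f g : polyfun f -> polyfun g -> polyfun (fun x => f x + g x)
| polyfunM f g : polyfun f -> polyfun g -> polyfun (fun x => f x * g x).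

Lemma polyfun_sum (R : realType) (m : nat) (I : Type) (s : seq I)
    (f : I -> 'rV[R]_m -> R) :
  (forall i, polyfun (f i)) -> polyfun (fun x => \sum_(i <- s) f i x).
Proof.
move=> hf; elim: s => [|i s IH].
  by under eq_fun do rewrite big_nil; exact: polyfun_cst.
by under eq_fun do rewrite big_cons; exact: polyfunD.
Qed.

(** Finite sums of products that separate the first coordinate from the others, the shape in which
    the inner integral can be carried out term by term. *)
Inductive sepfun (R : realType) (m : nat) : (R -> 'rV[R]_m -> R) -> Prop :=
| sepfun_term (p : {poly R}) g : polyfun g -> sepfun (fun x y => p.[x] * g y)
| sepfunD F G : sepfun F -> sepfun G -> sepfun (fun x y => F x y + G x y).

Lemma sepfunM (R : realType) (m : nat) (F G : R -> 'rV[R]_m -> R) :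
  sepfun F -> sepfun G -> sepfun (fun x y => F x y * G x y).
Proof.
elim=> [p f pf|F1 F2 _ IH1 _ IH2 sG]; last first.
  have -> : (fun x y => (F1 x y + F2 x y) * G x y)
      = (fun x y => F1 x y * G x y + F2 x y * G x y).
    by apply/funext => x; apply/funext => y; rewrite mulrDl.
  by apply: sepfunD; [exact: IH1|exact: IH2].
elim=> [q g pg|G1 G2 _ IH1 _ IH2].
  have -> : (fun (x : R) y => p.[x] * f y * (q.[x] * g y))
      = (fun x y => (p * q).[x] * (f y * g y)).
    by apply/funext => x; apply/funext => y; rewrite hornerM mulrACA.
  exact/sepfun_term/polyfunM.
have -> : (fun x y => p.[x] * f y * (G1 x y + G2 x y))
    = (fun x y => p.[x] * f y * G1 x y + p.[x] * f y * G2 x y).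
  by apply/funext => x; apply/funext => y; rewrite mulrDr.
exact: sepfunD.
Qed.

Lemma row_mx_coord0 (R : realType) (m : nat) (x : R) (y : 'rV[R]_m) (j : 'I_1) :
  (row_mx (x%:M : 'rV_1) y : 'rV_m.+1) 0 (lshift m j) = x.
Proof. by rewrite [LHS]row_mxEl (ord1 j) mxE eqxx. Qed.

Lemma row_mx_coordS (R : realType) (m : nat) (x : R) (y : 'rV[R]_m) (j : 'I_m) :
  (row_mx (x%:M : 'rV_1) y : 'rV_m.+1) 0 (rshift 1 j) = y 0 j.
Proof. exact: row_mxEr. Qed.

Lemma polyfun_sepfun (R : realType) (m : nat) (f : 'rV[R]_m.+1 -> R) :
  polyfun f -> sepfun (fun x y => f (row_mx (x%:M : 'rV_1) y)).
Proof.
elim=> [c|i|g h _ IHg _ IHh|g h _ IHg _ IHh]; last 2 first.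
- exact: sepfunD.
- exact: sepfunM.
- have := sepfun_term 1 (@polyfun_cst R m c).
  by under eq_fun do under eq_fun do rewrite hornerC mul1r.
- case: (split_ordP (i : 'I_(1 + m))) => j ->.
    have := sepfun_term 'X (@polyfun_cst R m 1).
    congr sepfun; apply/funext => x; apply/funext => y.
    by rewrite row_mx_coord0 hornerX mulr1.
  have := sepfun_term 1 (@polyfun_coord R m j).
  congr sepfun; apply/funext => x; apply/funext => y.
  by rewrite /= row_mx_coordS hornerC mul1r.
Qed.

Lemma polyfun_slice (R : realType) (m : nat) (f : 'rV[R]_m.+1 -> R) (x : R) :
  polyfun f -> polyfun (fun y => f (row_mx (x%:M : 'rV_1) y)).
Proof.
elim=> [c|i|g h _ IHg _ IHh|g h _ IHg _ IHh].
- exact: polyfun_cst.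
- case: (split_ordP (i : 'I_(1 + m))) => j ->.
    by under eq_fun do rewrite row_mx_coord0; exact: polyfun_cst.
  by under eq_fun do rewrite row_mx_coordS; exact: polyfun_coord.
- exact: polyfunD.
- exact: polyfunM.
Qed.

(** * Iterated integrals over slices of the open simplex *)

Definition open_simplex (R : realType) (m : nat) (r : R) : set 'rV[R]_m :=
  [set x | (forall i, 0 < x 0 i) /\ \sum_i x 0 i < r].

Lemma open_simplex_row_mx (R : realType) (m : nat) (r x : R) (y : 'rV[R]_m) :
  @open_simplex R m.+1 r (row_mx (x%:M : 'rV_1) y)
  <-> 0 < x /\ open_simplex (r - x) y.
Proof.
rewrite /open_simplex/=.
have -> : \sum_(i < m.+1) row_mx (x%:M : 'rV_1) y 0 i = x + \sum_i y 0 i.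
  rewrite (@big_split_ord _ _ _ 1 m)/= big_ord1 row_mx_coord0.
  by congr (_ + _); apply: eq_bigr => i _; rewrite row_mx_coordS.
rewrite ltrBrDl; split=> [[h1 h2]|[h1 [h2 h3]]]; split=> //.
- have := h1 (@lshift 1 m ord0).
  by rewrite row_mx_coord0.
- by split=> // i; have := h1 (@rshift 1 m i); rewrite row_mx_coordS.
- move=> i; case: (split_ordP (i : 'I_(1 + m))) => j ->.
    by rewrite row_mx_coord0.
  by rewrite row_mx_coordS.
Qed.

Lemma row_mx_scalar (R : realType) (m : nat) (z : 'rV[R]_m.+1) :
  exists x y, z = row_mx (x%:M : 'rV_1) y.
Proof.
exists (z 0 0), (@rsubmx _ 1 1 m z).
rewrite (_ : (z 0 0)%:M = @lsubmx _ 1 1 m z);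
  first by symmetry; exact: (@hsubmxK _ 1 1 m z).
apply/rowP => i; rewrite !mxE (ord1 i) eqxx mulr1n.
by congr (z _ _); exact: val_inj.
Qed.

Lemma in_itvoo (R : realType) (r x : R) : x \in `]0, r[%classic -> 0 < x < r.
Proof. by rewrite inE/= in_itv. Qed.

Lemma eq_ref_integral (R : realType) (m : nat) (r : R) (f g : 'rV[R]_m -> R) :
  0 < r -> {in open_simplex r, f =1 g} -> ref_integral r f = ref_integral r g.
Proof.
elim: m r f g => [|m IH] r f g r0 fg /=.
  by apply: fg; rewrite inE; split=> [[]|]//; rewrite big_ord0.
apply: eq_Rintegral => x /in_itvoo /andP[x0 xr].
apply: IH => [|y]; first by rewrite subr_gt0.
by rewrite inE => hy; apply: fg; rewrite inE; exact/open_simplex_row_mx.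
Qed.

Lemma ref_integral_ge0 (R : realType) (m : nat) (r : R) (f : 'rV[R]_m -> R) :
  0 < r -> (forall x, open_simplex r x -> 0 <= f x) -> 0 <= ref_integral r f.
Proof.
elim: m r f => [|m IH] r f r0 f0 /=.
  by apply: f0; split=> [[]|]//; rewrite big_ord0.
apply: Rintegral_ge0 => x /=; rewrite in_itv/= => /andP[x0 xr].
apply: IH => [|y hy]; first by rewrite subr_gt0.
by apply: f0; exact/open_simplex_row_mx.
Qed.

(** The three properties form one induction hypothesis: linearity of the outer integral needs inner
    integrals that are polynomial, hence integrable, and polynomial dependence on the size needs
    linearity in the lower dimension. *)
Definition ref_integral_spec (R : realType) (m : nat) : Prop :=
  [/\ forall f : 'rV[R]_m -> R, polyfun f ->
        exists p : {poly R}, forall r, 0 < r -> ref_integral r f = p.[r],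
      forall (r : R) (f g : 'rV[R]_m -> R), 0 < r -> polyfun f -> polyfun g ->
        ref_integral r (fun x => f x + g x)
        = ref_integral r f + ref_integral r g &
      forall (r c : R) (f : 'rV[R]_m -> R), 0 < r -> polyfun f ->
        ref_integral r (fun x => c * f x) = c * ref_integral r f].

Lemma ref_integral_sepfun (R : realType) (m : nat) (F : R -> 'rV[R]_m -> R) :
  ref_integral_spec R m -> sepfun F ->
  exists l : seq ({poly R} * {poly R}), forall x r, 0 < r ->
    ref_integral r (F x) = \sum_(pq <- l) pq.1.[x] * pq.2.[r].
Proof.
move=> [hA hB hC].
(* The induction carries along that every [F x] is polynomial, which additivity of the integral
   requires of both summands. *)
suff H : sepfun F -> (forall x, polyfun (F x)) /\
  exists l : seq ({poly R} * {poly R}), forall x r, 0 < r ->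
    ref_integral r (F x) = \sum_(pq <- l) pq.1.[x] * pq.2.[r].
  by move=> /H[].
elim=> [p g pg|G H _ [pG [lG hG]] _ [pH [lH hH]]]; split.
- by move=> x; apply: polyfunM => //; exact: polyfun_cst.
- have [q hq] := hA _ pg; exists [:: (p, q)] => x r r0.
  by rewrite big_seq1 hC// hq.
- by move=> x; exact: polyfunD.
- by exists (lG ++ lH) => x r r0; rewrite big_cat/= hB// hG// hH.
Qed.

(** Once the first coordinate is separated, integrating the remaining factor over the slice gives a
    polynomial in its size [r - x]; the outer integrand becomes a sum of convolution integrands. *)
Lemma ref_integral_slice (R : realType) (m : nat) (f : 'rV[R]_m.+1 -> R) :
  ref_integral_spec R m -> polyfun f ->
  exists l : seq ({poly R} * {poly R}), forall x r, 0 < x < r ->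
    ref_integral (r - x) (fun y => f (row_mx (x%:M : 'rV_1) y))
    = (\sum_(pq <- l) pq.1 * (pq.2 \Po (r%:P - 'X))).[x].
Proof.
move=> hm /polyfun_sepfun /(ref_integral_sepfun hm)[l hl].
exists l => x r /andP[x0 xr]; rewrite hl ?subr_gt0//.
rewrite horner_sum; apply: eq_bigr => pq _.
by rewrite hornerM horner_comp !hornerE.
Qed.

Lemma ref_integralP (R : realType) (m : nat) : ref_integral_spec R m.
Proof.
elim: m => [|m IH].
  split=> //= f _; exists (f 0)%:P => r _; by rewrite hornerC.
have slice (f : 'rV[R]_m.+1 -> R) : polyfun f ->
    forall r : R, exists P : {poly R}, forall x, 0 < x < r ->
    ref_integral (r - x) (fun y => f (row_mx (x%:M : 'rV_1) y)) = P.[x].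
  move=> pf r; have [l hl] := ref_integral_slice IH pf.
  by exists (\sum_(pq <- l) pq.1 * (pq.2 \Po (r%:P - 'X))) => x; exact: hl.
have [hA hB hC] := IH.
split=> [f pf|r f g r0 pf pg|r c f r0 pf] /=.
- have [l hl] := ref_integral_slice IH pf.
  suff [Z hZ] : exists Z : {poly R}, forall r, 0 <= r ->
      \int[lebesgue_measure]_(x in `]0, r[)
        (\sum_(pq <- l) pq.1 * (pq.2 \Po (r%:P - 'X))).[x] = Z.[r].
    exists Z => r r0; rewrite -hZ ?ltW//.
    by apply: eq_Rintegral => x /in_itvoo hx; rewrite hl.
  elim: {hl} l => [|[p q] l [Z hZ]].
    exists 0 => r r0; rewrite big_nil.
    by have := RintegralM_horner 0 0 0 r; rewrite scale0r mul0r horner0.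
  have [Y hY] := Rintegral_convolution q p.
  exists (Y + Z) => r r0; rewrite big_cons RintegralD_horner hornerD.
  by rewrite hY// hZ.
- have [P hP] := slice _ pf r; have [Q hQ] := slice _ pg r.
  transitivity (\int[lebesgue_measure]_(x in `]0, r[) (P + Q).[x]).
    apply: eq_Rintegral => x /in_itvoo hx; rewrite hornerD -hP// -hQ//.
    by case/andP: hx => _ hx; rewrite -hB ?subr_gt0//; exact: polyfun_slice.
  rewrite RintegralD_horner; congr (_ + _); apply: eq_Rintegral => x /in_itvoo hx.
    by rewrite hP.
  by rewrite hQ.
- have [P hP] := slice _ pf r.
  transitivity (\int[lebesgue_measure]_(x in `]0, r[) (c *: P).[x]).
    apply: eq_Rintegral => x /in_itvoo hx; rewrite hornerZ -hP//.
    by case/andP: hx => _ hx; rewrite -hC ?subr_gt0//; exact: polyfun_slice.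
  rewrite RintegralM_horner; congr (_ * _); apply: eq_Rintegral => x /in_itvoo hx.
  by rewrite hP.
Qed.

(** By induction on the dimension: the slice integrals form a nonnegative polynomial in [x] with
    vanishing integral, so they all vanish, and the induction hypothesis applies on each slice. *)
Lemma ref_integral_eq0 (R : realType) (m : nat) (r : R) (f : 'rV[R]_m -> R) :
  0 < r -> polyfun f -> (forall x, open_simplex r x -> 0 <= f x) ->
  ref_integral r f = 0 -> forall x, open_simplex r x -> f x = 0.
Proof.
elim: m r f => [|m IH] r f r0 pf f0 /=.
  by move=> h x _; rewrite -h; congr f; apply/rowP => -[].
have [l hl] := ref_integral_slice (ref_integralP R m) pf.
set P := \sum_(pq <- l) pq.1 * (pq.2 \Po (r%:P - 'X)) => h z.
have slice0 x y : 0 < x < r -> open_simplex (r - x) y ->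
    0 <= f (row_mx (x%:M : 'rV_1) y).
  by case/andP=> x0 xr hy; apply: f0; exact/open_simplex_row_mx.
have P0 : P = 0.
  apply: (Rintegral_horner_eq0 r0) => [x hx|].
    case/andP: (hx) => x0 xr.
    by rewrite -hl//; apply: ref_integral_ge0; [rewrite subr_gt0|move=> y; exact: slice0].
  by rewrite -[RHS]h; apply: eq_Rintegral => x /in_itvoo hx; rewrite -hl.
have [x [y ->]] := row_mx_scalar z.
move=> /open_simplex_row_mx[x0 hy].
have xr : x < r.
  rewrite -subr_gt0; apply: le_lt_trans hy.2.
  by apply: sumr_ge0 => i _; exact/ltW/hy.1.
have hx : 0 < x < r by rewrite x0.
apply: (IH (r - x) (fun y => f (row_mx (x%:M : 'rV_1) y))) hy.
- by rewrite subr_gt0.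
- exact: polyfun_slice.
- by move=> t; exact: slice0.
- by rewrite hl// -/P P0 horner0.
Qed.

(** * Bilinear forms *)

Lemma bformE (R : realType) (N : nat) (K : 'M[R]_N) (z y : 'cV[R]_N) :
  bform K z y = \sum_k \sum_j z k 0 * y j 0 * K k j.
Proof.
rewrite /bform -mulmxA mxE; apply: eq_bigr => k _.
rewrite !mxE mulr_sumr; apply: eq_bigr => j _; ring.
Qed.

Lemma bformDl (R : realType) (N : nat) (K : 'M[R]_N) (x y z : 'cV[R]_N) :
  bform K (x + y) z = bform K x z + bform K y z.
Proof. by rewrite /bform linearD/= !mulmxDl mxE. Qed.

Lemma bformDr (R : realType) (N : nat) (K : 'M[R]_N) (x y z : 'cV[R]_N) :
  bform K x (y + z) = bform K x y + bform K x z.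
Proof. by rewrite /bform mulmxDr mxE. Qed.

Lemma bformZl (R : realType) (N : nat) (K : 'M[R]_N) c (x y : 'cV[R]_N) :
  bform K (c *: x) y = c * bform K x y.
Proof. by rewrite /bform linearZ/= -!scalemxAl mxE. Qed.

Lemma bformZr (R : realType) (N : nat) (K : 'M[R]_N) c (x y : 'cV[R]_N) :
  bform K x (c *: y) = c * bform K x y.
Proof. by rewrite /bform -!scalemxAr mxE. Qed.

Lemma bformNl (R : realType) (N : nat) (K : 'M[R]_N) (x y : 'cV[R]_N) :
  bform K (- x) y = - bform K x y.
Proof. by rewrite -scaleN1r bformZl mulN1r. Qed.

Lemma bformNr (R : realType) (N : nat) (K : 'M[R]_N) (x y : 'cV[R]_N) :
  bform K x (- y) = - bform K x y.
Proof. by rewrite -scaleN1r bformZr mulN1r. Qed.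

Lemma bform_suml (R : realType) (N : nat) (K : 'M[R]_N) (I : Type) (s : seq I)
    (f : I -> 'cV[R]_N) y :
  bform K (\sum_(i <- s) f i) y = \sum_(i <- s) bform K (f i) y.
Proof. by rewrite /bform linear_sum/= !mulmx_suml summxE. Qed.

Lemma bform_sumr (R : realType) (N : nat) (K : 'M[R]_N) (I : Type) (s : seq I)
    (f : I -> 'cV[R]_N) y :
  bform K y (\sum_(i <- s) f i) = \sum_(i <- s) bform K y (f i).
Proof. by rewrite /bform mulmx_sumr summxE. Qed.

Lemma bform_mxD (R : realType) (N : nat) (K L : 'M[R]_N) (x y : 'cV[R]_N) :
  bform (K + L) x y = bform K x y + bform L x y.
Proof. by rewrite /bform mulmxDr mulmxDl mxE. Qed.

Lemma bform_mxB (R : realType) (N : nat) (K L : 'M[R]_N) (x y : 'cV[R]_N) :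
  bform (K - L) x y = bform K x y - bform L x y.
Proof. by rewrite /bform mulmxBr mulmxBl !mxE. Qed.

Lemma bform_mulr (R : realType) (N : nat) (K L : 'M[R]_N) (x y : 'cV[R]_N) :
  bform K x (L *m y) = bform (K *m L) x y.
Proof. by rewrite /bform !mulmxA. Qed.

Definition bform_lin :=
  (bformDl, bformDr, bformZl, bformZr, bformNl, bformNr).

Definition symform (R : realType) (N : nat) (K : 'M[R]_N) : Prop :=
  forall x y : 'cV[R]_N, bform K x y = bform K y x.

Definition posdef (R : realType) (N : nat) (K : 'M[R]_N) : Prop :=
  forall z : 'cV[R]_N, z != 0 -> 0 < qform K z.

Lemma posdef_ge0 (R : realType) (N : nat) (K : 'M[R]_N) :
  posdef K -> forall z : 'cV[R]_N, 0 <= qform K z.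
Proof.
move=> pK z; have [->|/pK/ltW//] := eqVneq z 0.
by rewrite /qform /bform mulmx0 mxE.
Qed.

(** A nonzero row in the left kernel of [K] would be a vector on which the quadratic form
    vanishes. *)
Lemma posdef_unitmx (R : realType) (N : nat) (K : 'M[R]_N) :
  posdef K -> K \in unitmx.
Proof.
move=> pK; rewrite -row_free_unit -kermx_eq0; apply/eqP/row_matrixP => i.
rewrite row0; apply/eqP/negPn/negP => hv.
have hz : (row i (kermx K))^T != 0 by rewrite -trmx0 (inj_eq trmx_inj).
have := pK _ hz; rewrite /qform /bform trmxK.
have /sub_kermxP -> := row_sub i (kermx K).
by rewrite mul0mx mxE ltxx.
Qed.

Lemma qform_scalar (R : realType) (N : nat) (z : 'cV[R]_N) (t : R) :
  qform (t%:M) z = t * \sum_i z i 0 ^+ 2.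
Proof.
rewrite /qform bformE mulr_sumr; apply: eq_bigr => k _.
rewrite (bigD1 k)//= mxE eqxx big1 ?addr0; first by rewrite expr2 mulrC.
by move=> j /negPf jk; rewrite mxE eq_sym jk mulr0.
Qed.

Lemma sqsum_gt0 (R : realType) (N : nat) (z : 'cV[R]_N) :
  z != 0 -> 0 < \sum_i z i 0 ^+ 2.
Proof.
move=> z0; rewrite lt0r sumr_ge0 ?andbT; last by move=> i _; exact: sqr_ge0.
apply: contra z0; rewrite psumr_eq0; last by move=> i _; exact: sqr_ge0.
move=> /allP h; apply/eqP/colP => i; rewrite mxE; apply/eqP.
by rewrite -sqrf_eq0; exact: (implyP (h i (mem_index_enum _))).
Qed.

(* det ((1 - t) K + t I) does not vanish on [0, 1] and is 1 at t = 1. *)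
Lemma posdef_det_gt0 (R : realType) (N : nat) (K : 'M[R]_N) :
  posdef K -> 0 < \det K.
Proof.
move=> pK; pose P : 'M[{poly R}]_N := (1 - 'X) *: map_mx polyC K + 'X%:M.
pose Kt t := (1 - t) *: K + t%:M.
have detP t : (\det P).[t] = \det (Kt t).
  rewrite -[LHS]/(horner_eval t (\det P)) -det_map_mx; congr (\det _).
  apply/matrixP => i j; rewrite !mxE /= horner_evalE.
  by rewrite hornerD hornerM hornerMn !hornerE.
rewrite ltNge; apply/negP => dK.
have [|t /andP[t0 t1]] := @poly_ivt R (\det P) 0 1 ler01.
  rewrite !detP /Kt subr0 subrr scale0r add0r det1 ler01 andbT.
  rewrite scale1r (_ : 0%:M = 0) ?addr0//.
  by apply/matrixP => i j; rewrite !mxE mul0rn.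
rewrite /root detP => /eqP d0.
have : Kt t \in unitmx.
  apply: posdef_unitmx => z z0; rewrite /qform bform_mxD.
  have -> : bform ((1 - t) *: K) z z = (1 - t) * qform K z.
    by rewrite /qform /bform -scalemxAr -scalemxAl mxE.
  rewrite -/(qform _ _) qform_scalar.
  have := pK _ z0; have := sqsum_gt0 z0; nra.
by rewrite unitmxE d0 unitr0.
Qed.

Lemma dotv_ge0 (R : realType) (d : nat) (x : 'rV[R]_d) : 0 <= dotv x x.
Proof. by apply: sumr_ge0 => i _; rewrite -expr2 sqr_ge0. Qed.

(** The form of the Gram matrix at [z] is the squared length of the combination of edges with
    coefficients [z]. The volume factor of a nondegenerate simplex is thus positive. *)
Lemma gram_det_gt0 (R : realType) (m d : nat) (p : 'I_m.+1 -> 'rV[R]_d) :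
  row_free (edges p) -> 0 < \det (gram p).
Proof.
move=> rf; apply: posdef_det_gt0 => z z0.
have -> : qform (gram p) z = \sum_i ((edges p)^T *m z) i 0 ^+ 2.
  rewrite /qform /bform /gram !mulmxA -mulmxA -{1}[edges p]trmxK -trmx_mul mxE.
  by apply: eq_bigr => i _; rewrite expr2 mxE.
apply: sqsum_gt0; apply: contra z0 => /eqP h.
have := congr1 trmx h; rewrite trmx_mul trmxK trmx0 -(mul0mx _ (edges p)).
by move/(row_free_inj rf)/(congr1 trmx); rewrite trmxK trmx0 => ->.
Qed.

(** * Finite element functions on a simplex *)

Lemma elt_integral_sum (R : realType) (m d : nat) (p : 'I_m.+1 -> 'rV[R]_d)
    (I : Type) (s : seq I) (f : I -> 'rV[R]_m -> R) :
  (forall i, polyfun (f i)) ->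
  elt_integral p (fun x => \sum_(i <- s) f i x)
  = \sum_(i <- s) elt_integral p (f i).
Proof.
have [_ hD hZ] := ref_integralP R m.
move=> hf; rewrite /elt_integral -mulr_sumr; congr (_ * _).
elim: s => [|i s IH].
  rewrite big_nil; under eq_fun do rewrite big_nil.
  have := hZ 1 0 _ ltr01 (@polyfun_cst R m 0).
  by under eq_fun do rewrite mul0r; rewrite mul0r.
rewrite big_cons -IH -hD//; last exact: polyfun_sum.
by congr ref_integral; apply/funext => x; rewrite big_cons.
Qed.

Lemma elt_integralZ (R : realType) (m d : nat) (p : 'I_m.+1 -> 'rV[R]_d)
    (c : R) (f : 'rV[R]_m -> R) :
  polyfun f -> elt_integral p (fun x => c * f x) = c * elt_integral p f.
Proof.
have [_ _ hZ] := ref_integralP R m.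
by move=> hf; rewrite /elt_integral hZ// mulrCA.
Qed.

Lemma elt_integralD (R : realType) (m d : nat) (p : 'I_m.+1 -> 'rV[R]_d)
    (f g : 'rV[R]_m -> R) : polyfun f -> polyfun g ->
  elt_integral p (fun x => f x + g x) = elt_integral p f + elt_integral p g.
Proof.
have [_ hD _] := ref_integralP R m.
by move=> hf hg; rewrite /elt_integral hD// mulrDr.
Qed.

Lemma eq_elt_integral (R : realType) (m d : nat) (p : 'I_m.+1 -> 'rV[R]_d)
    (f g : 'rV[R]_m -> R) : {in open_simplex 1, f =1 g} ->
  elt_integral p f = elt_integral p g.
Proof. by move=> fg; congr (_ * _); exact: eq_ref_integral. Qed.

Lemma elt_integral_ge0 (R : realType) (m d : nat) (p : 'I_m.+1 -> 'rV[R]_d)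
    (f : 'rV[R]_m -> R) : (forall x, open_simplex 1 x -> 0 <= f x) ->
  0 <= elt_integral p f.
Proof.
by move=> f0; apply: mulr_ge0; [exact: sqrtr_ge0|exact: ref_integral_ge0].
Qed.

Lemma le_elt_integral (R : realType) (m d : nat) (p : 'I_m.+1 -> 'rV[R]_d)
    (f g : 'rV[R]_m -> R) : polyfun f -> polyfun g ->
  (forall x, open_simplex 1 x -> f x <= g x) ->
  elt_integral p f <= elt_integral p g.
Proof.
move=> pf pg fg; rewrite -subr_ge0.
have pN : polyfun (fun x => -1 * f x) by apply: polyfunM => //; exact: polyfun_cst.
have -> : elt_integral p g - elt_integral p f
    = elt_integral p (fun x => g x + -1 * f x).
  by rewrite elt_integralD// elt_integralZ// mulN1r.
apply: elt_integral_ge0 => x hx.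
by rewrite mulN1r subr_ge0; exact: fg.
Qed.

(** * Barycentric coordinates and nodal basis functions *)

(** Indexed by global nodes, with indicators selecting the local vertex, so that sums over all nodes
    make sense; nodes off the simplex get the value 0. *)
Definition bary (R : realType) (m N : nat) (X : connectivity m N)
    (E : 'I_(nsimp X)) (j : 'I_N) (xi : 'rV[R]_m) : R :=
  (1 - \sum_k xi 0 k) * (j == vert E ord0)%:R
  + \sum_k xi 0 k * (j == vert E (lift ord0 k))%:R.

(** Values in an arbitrary module cover both scalar nodal values and node positions. *)
Lemma bary_sum (R : realType) (m N : nat) (X : connectivity m N)
    (V : lmodType R) (F : 'I_N -> V) (E : 'I_(nsimp X)) (xi : 'rV[R]_m) :
  \sum_j bary E j xi *: F j
  = (1 - \sum_k xi 0 k) *: F (vert E ord0)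
    + \sum_k xi 0 k *: F (vert E (lift ord0 k)).
Proof.
have aux c i : \sum_j (c * (j == i)%:R) *: F j = c *: F i.
  rewrite (bigD1 i)//= eqxx mulr1 big1 ?addr0// => j /negPf ->.
  by rewrite mulr0 scale0r.
rewrite /bary; under eq_bigr do rewrite scalerDl scaler_suml.
rewrite big_split/= aux exchange_big/=; congr (_ + _).
by apply: eq_bigr => k _; rewrite aux.
Qed.

Lemma bary_sum1 (R : realType) (m N : nat) (X : connectivity m N)
    (E : 'I_(nsimp X)) (xi : 'rV[R]_m) : \sum_j bary E j xi = 1.
Proof.
rewrite -[RHS](scale1r (1 : R^o)) -[X in X *: _](subrK (\sum_k xi 0 k)).
rewrite scalerDl scaler_suml -(bary_sum (fun=> 1 : R^o) E).
by apply: eq_bigr => j _; rewrite [RHS]mulr1.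
Qed.

Lemma bary_ge0 (R : realType) (m N : nat) (X : connectivity m N)
    (E : 'I_(nsimp X)) (j : 'I_N) (xi : 'rV[R]_m) :
  open_simplex 1 xi -> 0 <= bary E j xi.
Proof.
move=> [h1 h2]; apply: addr_ge0.
  by apply: mulr_ge0 => //; rewrite subr_ge0 ltW.
by apply: sumr_ge0 => k _; apply: mulr_ge0 => //; exact/ltW.
Qed.

Lemma polyfun_bary (R : realType) (m N : nat) (X : connectivity m N)
    (E : 'I_(nsimp X)) (j : 'I_N) : polyfun (@bary R m N X E j).
Proof.
apply: polyfunD.
  apply: polyfunM; last exact: polyfun_cst.
  apply: polyfunD; first exact: polyfun_cst.
  have -> : (fun x : 'rV[R]_m => - \sum_k x 0 k) = (fun x => -1 * \sum_k x 0 k).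
    by apply/funext => x; rewrite mulN1r.
  apply: polyfunM; first exact: polyfun_cst.
  by apply: polyfun_sum => i; exact: polyfun_coord.
apply: polyfun_sum => i; apply: polyfunM; last exact: polyfun_cst.
exact: polyfun_coord.
Qed.

Lemma vert_in_vset (m N : nat) (X : connectivity m N) (E : 'I_(nsimp X)) i :
  vert E i \in vset E.
Proof. exact: imset_f. Qed.

Lemma bary_notin (R : realType) (m N : nat) (X : connectivity m N)
    (E : 'I_(nsimp X)) (j : 'I_N) (xi : 'rV[R]_m) :
  j \notin vset E -> bary E j xi = 0.
Proof.
move=> hj; have hne i : (j == vert E i) = false.
  by apply: contraNF hj => /eqP ->; exact: vert_in_vset.
rewrite /bary hne mulr0 add0r big1// => k _; by rewrite hne mulr0.
Qed.

Lemma elt_mapE (R : realType) (m N d : nat) (X : connectivity m N)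
    (a : 'I_N -> 'rV[R]_d) (E : 'I_(nsimp X)) (xi : 'rV[R]_m) :
  elt_map (fun i => a (vert E i)) xi = \sum_j bary E j xi *: a j.
Proof.
rewrite bary_sum /elt_map mulmx_sum_row scalerBl scale1r -addrA; congr (_ + _).
rewrite scaler_suml -sumrN -big_split/=; apply: eq_bigr => k _.
by rewrite rowK scalerBr addrC.
Qed.

Lemma dotv_suml (R : realType) (d : nat) (I : Type) (s : seq I)
    (f : I -> 'rV[R]_d) x :
  dotv (\sum_(i <- s) f i) x = \sum_(i <- s) dotv (f i) x.
Proof.
rewrite /dotv exchange_big/=; apply: eq_bigr => i _.
by rewrite summxE mulr_suml.
Qed.

Lemma dotvC (R : realType) (d : nat) (x y : 'rV[R]_d) : dotv x y = dotv y x.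
Proof. by apply: eq_bigr => i _; rewrite mulrC. Qed.

Lemma dotv_sumr (R : realType) (d : nat) (I : Type) (s : seq I)
    (f : I -> 'rV[R]_d) x :
  dotv x (\sum_(i <- s) f i) = \sum_(i <- s) dotv x (f i).
Proof. by rewrite dotvC dotv_suml; apply: eq_bigr => i _; rewrite dotvC. Qed.

Lemma dotvZl (R : realType) (d : nat) c (x y : 'rV[R]_d) :
  dotv (c *: x) y = c * dotv x y.
Proof. by rewrite /dotv mulr_sumr; apply: eq_bigr => i _; rewrite mxE mulrA. Qed.

Lemma dotvZr (R : realType) (d : nat) c (x y : 'rV[R]_d) :
  dotv x (c *: y) = c * dotv x y.
Proof. by rewrite dotvC dotvZl dotvC. Qed.

(** On a simplex [chi j] is affine, hence determined by its vertex values, which are Kronecker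
    deltas; the image of [xi] is the convex combination of the vertices with weights
    [bary E k xi]. *)
Lemma chi_elt_map (R : realType) (m N : nat) (X : connectivity m N) (T : R)
    (a : R -> 'I_N -> 'rV[R]_m.+1) (chi : 'I_N -> R -> 'rV[R]_m.+1 -> R)
    (t : R) (E : 'I_(nsimp X)) (j : 'I_N) (xi : 'rV[R]_m) :
  nodal_basis X T a chi -> 0 <= t <= T -> open_simplex 1 xi ->
  chi j t (elt_map (elt (a t) E) xi) = bary E j xi.
Proof.
move=> hchi ht hxi; have [_ /(_ E)[g [b hgb]] hnode] := hchi t ht j.
have hv i : i \in vset E -> dotv g (a t i) + b = (j == i)%:R.
  move=> hi; rewrite -hgb ?hnode//; exists (fun k => (k == i)%:R); split.
  - by [].
  - by move=> k; case: eqVneq => [->|//]; rewrite hi.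
  - by rewrite (bigD1 i)//= eqxx big1 ?addr0// => k /negPf ->.
  - rewrite (bigD1 i)//= eqxx scale1r big1 ?addr0// => k /negPf ->.
    by rewrite scale0r.
rewrite (elt_mapE (a t)) hgb; last first.
  exists (fun k => bary E k xi); split=> //.
  - by move=> k; exact: bary_ge0.
  - by move=> k; exact: bary_notin.
  - exact: bary_sum1.
(* The weights sum to 1, so the constant [b] can be distributed over the vertices and joined to the
   linear part. *)
rewrite dotv_sumr -[b]mul1r -(bary_sum1 E xi) mulr_suml -big_split/=.
rewrite (bigD1 j)//= [X in _ + X]big1 ?addr0 => [|k kj]; last first.
  have [/hv hk|/bary_notin ->] := boolP (k \in vset E); last first.
    by rewrite scale0r mul0r addr0 -(scale0r 0) dotvZr mul0r.
  by rewrite dotvZr -mulrDr hk eq_sym (negPf kj) mulr0.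
have [/hv hk|/bary_notin ->] := boolP (j \in vset E); last first.
  by rewrite scale0r mul0r addr0 -(scale0r 0) dotvZr mul0r.
by rewrite dotvZr -mulrDr hk eqxx mulr1.
Qed.

Lemma bary_shift (R : realType) (m N : nat) (X : connectivity m N)
    (E : 'I_(nsimp X)) (j : 'I_N) (xi : 'rV[R]_m) (i : 'I_m) (h : R) :
  bary E j (h *: delta_mx 0 i + xi) = bary E j xi
    + h * ((j == vert E (lift ord0 i))%:R - (j == vert E ord0)%:R).
Proof.
have aux (F : 'I_m -> R) : \sum_k (h *: delta_mx 0 i + xi) 0 k * F k
    = h * F i + \sum_k xi 0 k * F k.
  under eq_bigr do rewrite !mxE eqxx/= mulrDl.
  rewrite big_split/=; congr (_ + _).
  rewrite (bigD1 i)//= eqxx mulr1 big1 ?addr0// => k /negPf ->.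
  by rewrite mulr0 mul0r.
rewrite /bary aux; have := aux (fun=> 1).
under eq_bigr do rewrite mulr1; move=> ->.
under eq_bigr do rewrite mulr1; ring.
Qed.

Lemma open_simplex_shift (R : realType) (m : nat) (xi : 'rV[R]_m) (i : 'I_m)
    (h : R) : open_simplex 1 xi -> `|h| < xi 0 i ->
  `|h| < 1 - \sum_k xi 0 k -> open_simplex 1 (h *: delta_mx 0 i + xi).
Proof.
move=> [x0 x1]; rewrite !ltr_norml => /andP[h1 h2] /andP[h3 h4]; split.
  move=> k; rewrite !mxE eqxx/=; have [->|_] := eqVneq k i.
    by rewrite mulr1; lra.
  by rewrite mulr0 add0r.
under eq_bigr do rewrite !mxE eqxx/=.
rewrite big_split/= (bigD1 i)//= eqxx mulr1 big1; first lra.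
by move=> k /negPf ->; rewrite mulr0.
Qed.

(** Small shifts of [xi] stay inside the open simplex, where the pull-back is affine; the difference
    quotient is therefore constant near 0. *)
Lemma derive_chi_elt_map (R : realType) (m N : nat) (X : connectivity m N) (T : R)
    (a : R -> 'I_N -> 'rV[R]_m.+1) (chi : 'I_N -> R -> 'rV[R]_m.+1 -> R)
    (t : R) (E : 'I_(nsimp X)) (j : 'I_N) (xi : 'rV[R]_m) (i : 'I_m) :
  nodal_basis X T a chi -> 0 <= t <= T -> open_simplex 1 xi ->
  'D_(delta_mx 0 i) (chi j t \o elt_map (elt (a t) E)) xi
  = (j == vert E (lift ord0 i))%:R - (j == vert E ord0)%:R.
Proof.
move=> hchi ht hxi; apply: cvg_lim => //; apply: cvg_near_cst.
near=> h.
have hs : open_simplex 1 (h *: delta_mx 0 i + xi).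
  apply: open_simplex_shift => //.
    by near: h; apply: dnbhs0_lt; exact: hxi.1.
  by near: h; apply: dnbhs0_lt; rewrite subr_gt0; exact: hxi.2.
rewrite /= !(chi_elt_map _ _ hchi)// bary_shift addrC addKr.
rewrite scalerA mulVf ?scale1r//.
by near: h; exact: nbhs_dnbhs_neq.
Unshelve. all: by end_near.
Qed.

(** The tangential gradient of the basis function, constant on the simplex: the derivatives of the
    barycentric coordinate are inserted in the formula of [tgrad]. *)
Definition elt_grad (R : realType) (m N : nat) (X : connectivity m N)
    (a : 'I_N -> 'rV[R]_m.+1) (E : 'I_(nsimp X)) (j : 'I_N) : 'rV[R]_m.+1 :=
  (\row_i ((j == vert E (lift ord0 i))%:R - (j == vert E ord0)%:R))
    *m invmx (gram (elt a E)) *m edges (elt a E).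

Lemma tgrad_chi (R : realType) (m N : nat) (X : connectivity m N) (T : R)
    (a : R -> 'I_N -> 'rV[R]_m.+1) (chi : 'I_N -> R -> 'rV[R]_m.+1 -> R)
    (t : R) (E : 'I_(nsimp X)) (j : 'I_N) (xi : 'rV[R]_m) :
  nodal_basis X T a chi -> 0 <= t <= T -> open_simplex 1 xi ->
  tgrad (elt (a t) E) (chi j t) xi = elt_grad (a t) E j.
Proof.
move=> hchi ht hxi; congr (_ *m _ *m _); apply/rowP => i.
by rewrite !mxE (derive_chi_elt_map _ _ _ hchi).
Qed.

(** * Mass, stiffness and advection matrices *)

(** Pull-back to the reference simplex of the finite element function with nodal vector [z]. *)
Definition fe_fun (R : realType) (m N : nat) (X : connectivity m N)
    (E : 'I_(nsimp X)) (z : 'cV[R]_N) (xi : 'rV[R]_m) : R :=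
  \sum_j z j 0 * bary E j xi.

Definition fe_grad (R : realType) (m N : nat) (X : connectivity m N)
    (a : 'I_N -> 'rV[R]_m.+1) (E : 'I_(nsimp X)) (z : 'cV[R]_N) : 'rV[R]_m.+1 :=
  \sum_j z j 0 *: elt_grad a E j.

Lemma polyfun_fe (R : realType) (m N : nat) (X : connectivity m N)
    (E : 'I_(nsimp X)) (z : 'cV[R]_N) : polyfun (@fe_fun R m N X E z).
Proof.
apply: polyfun_sum => j; apply: polyfunM; [exact: polyfun_cst|].
exact: polyfun_bary.
Qed.

(** Here [f] is the integrand as the matrix defines it and [g] a polynomial that agrees with it on
    the open simplex; linearity of the integral is available only for [g]. *)
Lemma bform_elt_integral (R : realType) (m d N n : nat)
    (p : 'I_n -> 'I_m.+1 -> 'rV[R]_d) (f g : 'I_n -> 'I_N -> 'I_N -> 'rV[R]_m -> R)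
    (z y : 'cV[R]_N) :
  (forall E k j, polyfun (g E k j)) ->
  (forall E k j, {in open_simplex 1, f E k j =1 g E k j}) ->
  bform (\matrix_(k, j) \sum_(E < n) elt_integral (p E) (f E k j)) z y
  = \sum_(E < n) elt_integral (p E)
      (fun xi => \sum_k \sum_j z k 0 * y j 0 * g E k j xi).
Proof.
move=> pg fg; rewrite bformE.
have pzg E k j : polyfun (fun xi => z k 0 * y j 0 * g E k j xi).
  by apply: polyfunM => //; exact: polyfun_cst.
under [RHS]eq_bigr => E _.
  rewrite elt_integral_sum; last by move=> k; exact: polyfun_sum.
  under eq_bigr do rewrite elt_integral_sum//.
  over.
rewrite /= [RHS]exchange_big/=; apply: eq_bigr => k _.
rewrite exchange_big/=; apply: eq_bigr => j _.
rewrite mxE mulr_sumr; apply: eq_bigr => E _.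
by rewrite elt_integralZ//; congr (_ * _); apply: eq_elt_integral; exact: fg.
Qed.

Lemma bform_mass (R : realType) (m N : nat) (X : connectivity m N) (T : R)
    (a : R -> 'I_N -> 'rV[R]_m.+1) (chi : 'I_N -> R -> 'rV[R]_m.+1 -> R)
    (t : R) (z y : 'cV[R]_N) : nodal_basis X T a chi -> 0 <= t <= T ->
  bform (mass X a chi t) z y = \sum_(E < nsimp X)
    elt_integral (elt (a t) E) (fun xi => fe_fun E z xi * fe_fun E y xi).
Proof.
move=> hchi ht; rewrite (@bform_elt_integral _ _ _ _ _ _ _ (fun E k j xi =>
  bary E j xi * bary E k xi)).
- apply: eq_bigr => E _; congr elt_integral; apply/funext => xi.
  rewrite /fe_fun big_distrlr/=; apply: eq_bigr => k _; apply: eq_bigr => j _.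
  ring.
- by move=> E k j; apply: polyfunM; exact: polyfun_bary.
- by move=> E k j xi; rewrite inE => hxi /=; rewrite !(chi_elt_map _ _ hchi).
Qed.

Lemma bform_stiffness (R : realType) (m N : nat) (X : connectivity m N) (T : R)
    (a : R -> 'I_N -> 'rV[R]_m.+1) (chi : 'I_N -> R -> 'rV[R]_m.+1 -> R)
    (t : R) (z y : 'cV[R]_N) : nodal_basis X T a chi -> 0 <= t <= T ->
  bform (stiffness X a chi t) z y = \sum_(E < nsimp X)
    elt_integral (elt (a t) E)
      (fun=> dotv (fe_grad (a t) E z) (fe_grad (a t) E y)).
Proof.
move=> hchi ht; rewrite (@bform_elt_integral _ _ _ _ _ _ _ (fun E k j _ =>
  dotv (elt_grad (a t) E j) (elt_grad (a t) E k))).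
- apply: eq_bigr => E _; congr elt_integral; apply/funext => xi.
  rewrite /fe_grad dotv_suml; apply: eq_bigr => k _.
  rewrite dotv_sumr; apply: eq_bigr => j _.
  by rewrite dotvZl dotvZr mulrA dotvC.
- by move=> E k j; exact: polyfun_cst.
- by move=> E k j xi; rewrite inE => hxi /=; rewrite !(tgrad_chi _ _ hchi).
Qed.

(** Rows belong to test functions: the gradient falls on [z], the function value on [y]. The
    interpolated velocity difference is expanded over the nodes with barycentric weights. *)
Lemma bform_advection (R : realType) (m N : nat) (X : connectivity m N) (T : R)
    (a : R -> 'I_N -> 'rV[R]_m.+1) (chi : 'I_N -> R -> 'rV[R]_m.+1 -> R)
    (v w : 'rV[R]_m.+1 -> R -> 'rV[R]_m.+1)
    (t : R) (z y : 'cV[R]_N) : nodal_basis X T a chi -> 0 <= t <= T ->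
  bform (advection X a chi v w t) z y = \sum_(E < nsimp X)
    elt_integral (elt (a t) E) (fun xi => fe_fun E y xi *
      \sum_l bary E l xi * dotv (w (a t l) t - v (a t l) t) (fe_grad (a t) E z)).
Proof.
move=> hchi ht; rewrite (@bform_elt_integral _ _ _ _ _ _ _ (fun E k j xi =>
  bary E j xi * \sum_l bary E l xi *
    dotv (w (a t l) t - v (a t l) t) (elt_grad (a t) E k))).
- apply: eq_bigr => E _; congr elt_integral; apply/funext => xi.
  rewrite /fe_fun mulr_suml exchange_big/=; apply: eq_bigr => j _.
  under [in RHS]eq_bigr do rewrite dotv_sumr.
  under [in RHS]eq_bigr do rewrite mulr_sumr.
  rewrite [in RHS]exchange_big/= mulr_sumr; apply: eq_bigr => k _.
  under [in RHS]eq_bigr do rewrite dotvZr mulrCA.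
  rewrite -mulr_sumr; ring.
- move=> E k j; apply: polyfunM; first exact: polyfun_bary.
  apply: polyfun_sum => l; apply: polyfunM; last exact: polyfun_cst.
  exact: polyfun_bary.
- move=> E k j xi; rewrite inE => hxi /=.
  rewrite (chi_elt_map _ _ hchi)// (tgrad_chi _ _ hchi)//; congr (_ * _).
  rewrite /interp -sumrB dotv_suml; apply: eq_bigr => l _.
  by rewrite (chi_elt_map _ _ hchi)// -scalerBr dotvZl.
Qed.

Lemma mass_sym (R : realType) (m N : nat) (X : connectivity m N) (T : R)
    (a : R -> 'I_N -> 'rV[R]_m.+1) (chi : 'I_N -> R -> 'rV[R]_m.+1 -> R) (t : R) :
  nodal_basis X T a chi -> 0 <= t <= T -> symform (mass X a chi t).
Proof.
move=> hchi ht z y; rewrite !(bform_mass _ _ hchi)//; apply: eq_bigr => E _.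
by congr elt_integral; apply/funext => xi; rewrite mulrC.
Qed.

Lemma stiffness_sym (R : realType) (m N : nat) (X : connectivity m N) (T : R)
    (a : R -> 'I_N -> 'rV[R]_m.+1) (chi : 'I_N -> R -> 'rV[R]_m.+1 -> R) (t : R) :
  nodal_basis X T a chi -> 0 <= t <= T -> symform (stiffness X a chi t).
Proof.
move=> hchi ht z y; rewrite !(bform_stiffness _ _ hchi)//; apply: eq_bigr => E _.
by congr elt_integral; apply/funext => xi; rewrite dotvC.
Qed.

Lemma stiffness_ge0 (R : realType) (m N : nat) (X : connectivity m N) (T : R)
    (a : R -> 'I_N -> 'rV[R]_m.+1) (chi : 'I_N -> R -> 'rV[R]_m.+1 -> R) (t : R)
    (z : 'cV[R]_N) :
  nodal_basis X T a chi -> 0 <= t <= T -> 0 <= qform (stiffness X a chi t) z.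
Proof.
move=> hchi ht; rewrite /qform (bform_stiffness _ _ hchi)//.
apply: sumr_ge0 => E _; apply: elt_integral_ge0 => xi _; exact: dotv_ge0.
Qed.

(** The double sum is the integral of the form of [G] at the vector of values of the functions
    [Y i], which is nonnegative at every point. *)
Lemma mass_tensor_ge0 (R : realType) (m N : nat) (X : connectivity m N) (T : R)
    (a : R -> 'I_N -> 'rV[R]_m.+1) (chi : 'I_N -> R -> 'rV[R]_m.+1 -> R) (t : R)
    (s : nat) (G : 'M[R]_s) (Y : 'I_s -> 'cV[R]_N) :
  nodal_basis X T a chi -> 0 <= t <= T -> (forall x, 0 <= qform G x) ->
  0 <= \sum_i \sum_j G i j * bform (mass X a chi t) (Y i) (Y j).
Proof.
move=> hchi ht hG.
have pY E i j : polyfun (fun xi => G i j * (fe_fun (X := X) E (Y i) xi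
    * fe_fun E (Y j) xi)).
  apply: polyfunM; first exact: polyfun_cst.
  by apply: polyfunM; exact: polyfun_fe.
suff -> : \sum_i \sum_j G i j * bform (mass X a chi t) (Y i) (Y j)
    = \sum_(E < nsimp X) elt_integral (elt (a t) E) (fun xi =>
        qform G (\col_i fe_fun E (Y i) xi)).
  by apply: sumr_ge0 => E _; apply: elt_integral_ge0 => xi _; exact: hG.
under [RHS]eq_bigr => E _.
  under eq_fun => xi.
    rewrite /qform bformE; under eq_bigr => i _.
      under eq_bigr => j _ do rewrite !mxE mulrC.
      over.
    over.
  rewrite elt_integral_sum; last by move=> i; exact: polyfun_sum.
  under eq_bigr do rewrite elt_integral_sum//.
  over.
rewrite /= [RHS]exchange_big/=; apply: eq_bigr => i _.
rewrite exchange_big/=; apply: eq_bigr => j _.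
rewrite (bform_mass _ _ hchi)// mulr_sumr; apply: eq_bigr => E _.
by rewrite elt_integralZ//; apply: polyfunM; exact: polyfun_fe.
Qed.

Lemma fe_funE (R : realType) (m N : nat) (X : connectivity m N)
    (E : 'I_(nsimp X)) (z : 'cV[R]_N) (xi : 'rV[R]_m) :
  fe_fun E z xi = (1 - \sum_k xi 0 k) * z (vert E ord0) 0
    + \sum_k xi 0 k * z (vert E (lift ord0 k)) 0.
Proof.
rewrite -[RHS](bary_sum (fun j => z j 0 : R^o)); apply: eq_bigr => j _.
exact: mulrC.
Qed.

Lemma fe_fun_shift (R : realType) (m N : nat) (X : connectivity m N)
    (E : 'I_(nsimp X)) (z : 'cV[R]_N) (xi : 'rV[R]_m) (i : 'I_m) (h : R) :
  fe_fun E z (h *: delta_mx 0 i + xi) = fe_fun E z xi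
    + h * (z (vert E (lift ord0 i)) 0 - z (vert E ord0) 0).
Proof.
have aux k : \sum_j z j 0 * (j == k)%:R = z k 0.
  rewrite (bigD1 k)//= eqxx mulr1 big1 ?addr0// => j /negPf ->.
  by rewrite mulr0.
rewrite -(aux (vert E (lift _ _))) -(aux (vert E ord0)) -sumrB mulr_sumr.
rewrite /fe_fun -big_split/=; apply: eq_bigr => j _; rewrite bary_shift; ring.
Qed.

(** Comparing an interior point with its shift along a coordinate direction shows that all vertex
    values agree with the one at vertex 0; the value at the point itself then shows that this common
    value is 0. *)
Lemma fe_fun_eq0 (R : realType) (m N : nat) (X : connectivity m N)
    (E : 'I_(nsimp X)) (z : 'cV[R]_N) :
  (forall xi : 'rV[R]_m, open_simplex 1 xi -> fe_fun E z xi = 0) ->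
  forall i, z (vert E i) 0 = 0.
Proof.
(* With this [c] the constant point has coordinate sum at most 1/2, which leaves room for a shift by
   [c / 2] in any direction. *)
move=> hz; pose c : R := (2 * m.+1%:R)^-1.
have c0 : 0 < c by rewrite invr_gt0 mulr_gt0.
have hm : m%:R * c <= 2^-1.
  rewrite ler_pdivrMr ?mulr_gt0// mulrA mulVf ?mul1r ?ler_nat//.
pose xi : 'rV[R]_m := const_mx c.
have sxi : \sum_k xi 0 k = m%:R * c.
  by under eq_bigr do rewrite mxE; rewrite sumr_const card_ord mulr_natl.
have hxi : open_simplex 1 xi.
  by split=> [k|]; [rewrite mxE|rewrite sxi; lra].
have hc : c <= 2^-1.
  by rewrite /c lef_pV2 ?posrE ?mulr_gt0// ler_peMr// ler1n.
have zi i : z (vert E (lift ord0 i)) 0 = z (vert E ord0) 0.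
  have hs : open_simplex 1 (c / 2 *: delta_mx 0 i + xi).
    by apply: open_simplex_shift => //; rewrite ?sxi ?mxE gtr0_norm; lra.
  have := hz _ hs; rewrite fe_fun_shift hz// add0r => /eqP.
  by rewrite mulf_eq0 gt_eqF ?divr_gt0//= subr_eq0 => /eqP.
have z0 : z (vert E ord0) 0 = 0.
  have := hz _ hxi; rewrite fe_funE.
  have -> : \sum_k xi 0 k * z (vert E (lift ord0 k)) 0
      = \sum_k xi 0 k * z (vert E ord0) 0 by apply: eq_bigr => k _; rewrite zi.
  by rewrite -mulr_suml -mulrDl subrK mul1r.
move=> i; case: (unliftP ord0 i) => [k ->|-> //]; by rewrite zi.
Qed.

(** If the form vanishes, so does every element integral of a square; positive volume factors make
    the function zero on each simplex, and every node is a vertex of some simplex. *)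
Lemma mass_posdef (R : realType) (m N : nat) (X : connectivity m N) (T c h : R)
    (a : R -> 'I_N -> 'rV[R]_m.+1) (chi : 'I_N -> R -> 'rV[R]_m.+1 -> R) (t : R) :
  admissible X T c h a -> nodal_basis X T a chi -> 0 <= t <= T ->
  posdef (mass X a chi t).
Proof.
move=> [hcov _ _ _ /(_ t) hadm] hchi ht z z0; have [hfree _ _] := hadm ht.
rewrite /qform (bform_mass _ _ hchi)//.
have I0 E : 0 <= elt_integral (elt (a t) E) (fun xi => fe_fun E z xi * fe_fun E z xi).
  by apply: elt_integral_ge0 => xi _; rewrite -expr2 sqr_ge0.
rewrite lt0r sumr_ge0 ?andbT; last by move=> E _; exact: I0.
apply: contra z0; rewrite psumr_eq0// => /allP h0.
apply/eqP/colP => j; rewrite mxE; have [E /imsetP[i _ ->]] := hcov j.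
apply: fe_fun_eq0 => xi hxi.
have /eqP := implyP (h0 E (mem_index_enum _)) isT.
rewrite /elt_integral => /eqP; rewrite mulf_eq0 sqrtr_eq0 leNgt.
rewrite gram_det_gt0//= => /eqP hI.
have /eqP : fe_fun E z xi * fe_fun E z xi = 0.
  apply: (ref_integral_eq0 _ _ _ hI) => //.
    by apply: polyfunM; exact: polyfun_fe.
  by move=> x _; rewrite -expr2 sqr_ge0.
by rewrite mulf_eq0 orbb => /eqP.
Qed.

(** Expansion of the squared length of [2 eps g - b x], divided by [4 eps]. *)
Lemma dotv_young (R : realType) (d : nat) (x g : 'rV[R]_d) (b L eps : R) :
  0 < eps -> enorm x <= L ->
  b * dotv x g <= eps * dotv g g + L ^+ 2 / (4 * eps) * (b * b).
Proof.
move=> e0 hx; have xL : dotv x x <= L ^+ 2.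
  rewrite -(sqr_sqrtr (dotv_ge0 x)) ler_sqr ?nnegrE ?sqrtr_ge0//.
  by rewrite (le_trans _ hx)// sqrtr_ge0.
have : 0 <= dotv (2 * eps *: g - b *: x) (2 * eps *: g - b *: x) by exact: dotv_ge0.
have -> : dotv (2 * eps *: g - b *: x) (2 * eps *: g - b *: x) =
    4 * eps ^+ 2 * dotv g g - 4 * eps * (b * dotv x g) + b ^+ 2 * dotv x x.
  rewrite /dotv !mulr_sumr -sumrB -big_split/=; apply: eq_bigr => i _.
  rewrite !mxE; ring.
have e4 : 0 < 4 * eps by lra.
move=> h; rewrite -(ler_pM2l e4).
have -> : 4 * eps * (eps * dotv g g + L ^+ 2 / (4 * eps) * (b * b))
    = 4 * eps ^+ 2 * dotv g g + b ^+ 2 * L ^+ 2.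
  by field; rewrite gt_eqF.
have := ler_wpM2l (sqr_ge0 b) xL; lra.
Qed.

(** The barycentric weights are nonnegative with sum 1, so the integrand and its bound are both
    averages over the nodes. Young's inequality is applied at each node, where the velocity
    difference is at most [L]. *)
Lemma advection_bound (R : realType) (m N : nat) (X : connectivity m N) (T : R)
    (a : R -> 'I_N -> 'rV[R]_m.+1) (chi : 'I_N -> R -> 'rV[R]_m.+1 -> R)
    (v w : 'rV[R]_m.+1 -> R -> 'rV[R]_m.+1) (L eps t : R) (z y : 'cV[R]_N) :
  nodal_basis X T a chi -> 0 <= t <= T ->
  (forall j, enorm (w (a t j) t - v (a t j) t) <= L) -> 0 < eps ->
  bform (advection X a chi v w t) z y
  <= eps * qform (stiffness X a chi t) z
     + L ^+ 2 / (4 * eps) * qform (mass X a chi t) y.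
Proof.
move=> hchi ht hL e0.
rewrite /qform (bform_advection _ _ _ _ hchi)// (bform_stiffness _ _ hchi)//.
rewrite (bform_mass _ _ hchi)// !mulr_sumr -big_split/=; apply: ler_sum => E _.
have pyy : polyfun (fun xi => fe_fun (X := X) E y xi * fe_fun E y xi).
  by apply: polyfunM; exact: polyfun_fe.
have pc := polyfun_cst m (dotv (fe_grad (a t) E z) (fe_grad (a t) E z)).
have pZ k (f : 'rV[R]_m -> R) : polyfun f -> polyfun (fun xi => k * f xi).
  by move=> pf; apply: polyfunM => //; exact: polyfun_cst.
rewrite -!elt_integralZ// -elt_integralD; [|exact: pZ|exact: pZ].
apply: le_elt_integral.
- apply: polyfunM; first exact: polyfun_fe.
  apply: polyfun_sum => l; apply: polyfunM; last exact: polyfun_cst.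
  exact: polyfun_bary.
- by apply: polyfunD; exact: pZ.
move=> xi hxi; rewrite -[leRHS]mul1r; set rhs := (X in _ <= 1 * X).
rewrite -(bary_sum1 E xi) mulr_sumr mulr_suml.
apply: ler_sum => l _; rewrite mulrCA.
apply: ler_wpM2l; first exact: bary_ge0.
exact: dotv_young e0 (hL l).
Qed.

(** * Energy estimates for one Runge-Kutta step *)

Lemma symform_tr (R : realType) (N : nat) (K : 'M[R]_N) :
  symform K -> K^T = K.
Proof.
move=> sK; apply/matrixP => i j; rewrite mxE.
have aux (L : 'M[R]_N) k l : bform L (delta_mx k 0) (delta_mx l 0) = L k l.
  by rewrite /bform trmx_delta -rowE -colE !mxE.
by rewrite -!aux sK.
Qed.

Lemma qformDE (R : realType) (N : nat) (K : 'M[R]_N) (x y : 'cV[R]_N) :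
  symform K -> qform K (x + y) = qform K x + 2 * bform K x y + qform K y.
Proof. move=> sK; rewrite /qform !bform_lin (sK y x); ring. Qed.

Lemma qformZ (R : realType) (N : nat) (K : 'M[R]_N) c (x : 'cV[R]_N) :
  qform K (c *: x) = c ^+ 2 * qform K x.
Proof. rewrite /qform !bform_lin; ring. Qed.

Lemma qformN (R : realType) (N : nat) (K : 'M[R]_N) (x : 'cV[R]_N) :
  qform K (- x) = qform K x.
Proof. by rewrite /qform !bform_lin opprK. Qed.

Lemma qform_mxD (R : realType) (N : nat) (K L : 'M[R]_N) (x : 'cV[R]_N) :
  qform (K + L) x = qform K x + qform L x.
Proof. exact: bform_mxD. Qed.

Lemma bform_young (R : realType) (N : nat) (K : 'M[R]_N) (e : R) (x y : 'cV[R]_N) :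
  symform K -> (forall z, 0 <= qform K z) -> 0 < e ->
  bform K x y <= e * qform K x + (4 * e)^-1 * qform K y.
Proof.
move=> sK pK e0; have := pK (2 * e *: x - y).
rewrite qformDE// qformZ qformN bformNr bformZl => h.
have e4 : 0 < 4 * e by lra.
rewrite -(ler_pM2l e4) mulrDr !mulrA divff ?gt_eqF// mul1r; nra.
Qed.

Lemma qformD_le (R : realType) (N : nat) (K : 'M[R]_N) (x y : 'cV[R]_N) :
  symform K -> (forall z, 0 <= qform K z) ->
  qform K (x + y) <= 2 * qform K x + 2 * qform K y.
Proof.
move=> sK pK; have := pK (x - y); rewrite !qformDE// qformN bformNr; lra.
Qed.

Lemma qform_sum_le (R : realType) (N : nat) (K : 'M[R]_N) (n : nat)
    (f : 'I_n -> 'cV[R]_N) :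
  symform K -> (forall z, 0 <= qform K z) ->
  qform K (\sum_i f i) <= n%:R * \sum_i qform K (f i).
Proof.
move=> sK pK; rewrite /qform bform_suml.
have h i j : bform K (f i) (f j) <= 2^-1 * qform K (f i) + 2^-1 * qform K (f j).
  by have := @bform_young _ _ K 2^-1 (f i) (f j) sK pK;
    rewrite (_ : (4 * 2^-1)^-1 = 2^-1 :> R); [apply; lra|field].
apply: (@le_trans _ _ (\sum_i \sum_j
    (2^-1 * qform K (f i) + 2^-1 * qform K (f j)))).
  by apply: ler_sum => i _; rewrite bform_sumr; apply: ler_sum => j _; exact: h.
under eq_bigr do rewrite big_split/= sumr_const card_ord -mulr_sumr.
rewrite big_split/= sumr_const card_ord sumrMnl -mulr_sumr.
rewrite -mulrnDl -mulrDl (_ : 2^-1 + 2^-1 = 1 :> R); last by field.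
by rewrite mul1r mulr_natl.
Qed.

Lemma symform_inv (R : realType) (N : nat) (M : 'M[R]_N) :
  symform M -> symform (invmx M).
Proof.
move=> /symform_tr sM x y; rewrite /bform -[LHS]trace_mx11 -mxtrace_tr.
by rewrite !trmx_mul trmxK trmx_inv sM trace_mx11 mulmxA.
Qed.

Lemma bform_inv (R : realType) (N : nat) (M : 'M[R]_N) (x y : 'cV[R]_N) :
  symform M -> M \in unitmx ->
  bform (invmx M) x y = bform M (invmx M *m x) (invmx M *m y).
Proof.
move=> sM uM; rewrite bform_mulr mulmxV// {2}/bform trmx_mul trmx_inv.
by rewrite symform_tr// mulmx1 /bform.
Qed.

Lemma qform_inv_mul (R : realType) (N : nat) (M : 'M[R]_N) (x : 'cV[R]_N) :
  symform M -> M \in unitmx -> qform (invmx M) (M *m x) = qform M x.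
Proof. by move=> sM uM; rewrite /qform bform_inv// mulKmx. Qed.

Lemma posdef_inv_ge0 (R : realType) (N : nat) (M : 'M[R]_N) :
  symform M -> posdef M -> forall x, 0 <= qform (invmx M) x.
Proof.
move=> sM pM x; rewrite /qform bform_inv//; last exact: posdef_unitmx.
exact: posdef_ge0.
Qed.

(** [bform 1%:M] serves as the Euclidean pairing between nodal vectors and load vectors such as
    [M *m y]. *)
Lemma bform1_mul (R : realType) (N : nat) (M : 'M[R]_N) (x y : 'cV[R]_N) :
  bform 1%:M x (M *m y) = bform M x y.
Proof. by rewrite bform_mulr mul1mx. Qed.

Lemma bform1C (R : realType) (N : nat) (x y : 'cV[R]_N) :
  bform 1%:M x y = bform 1%:M y x.
Proof.
by rewrite /bform !mulmx1 -[LHS]trace_mx11 -mxtrace_tr trmx_mul trmxK trace_mx11.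
Qed.

Lemma bform_inv_mul (R : realType) (N : nat) (M : 'M[R]_N) (x y : 'cV[R]_N) :
  M \in unitmx -> bform (invmx M) x (M *m y) = bform 1%:M x y.
Proof. by move=> uM; rewrite bform_mulr mulVmx. Qed.

(** Young's inequality in the form of [M], after writing the load vector [y] as [M] applied to
    [invmx M *m y]. *)
Lemma dual_young (R : realType) (N : nat) (M : 'M[R]_N) (e : R) (x y : 'cV[R]_N) :
  symform M -> posdef M -> 0 < e ->
  bform 1%:M x y <= e * qform M x + (4 * e)^-1 * qform (invmx M) y.
Proof.
move=> sM pM e0; have uM := posdef_unitmx pM.
rewrite -[y](mulKVmx uM) bform1_mul qform_inv_mul//.
by apply: bform_young => //; exact: posdef_ge0.
Qed.

(** Positivity of the Kronecker product of [K] with any positive semi-definite [G]. It is what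
    algebraic stability is paired with, and it avoids matrix square roots. *)
Definition tensor_ge0 (R : realType) (N : nat) (K : 'M[R]_N) : Prop :=
  forall (s : nat) (G : 'M[R]_s) (Y : 'I_s -> 'cV[R]_N),
    (forall x, 0 <= qform G x) ->
    0 <= \sum_i \sum_j G i j * bform K (Y i) (Y j).

Lemma tensor_ge0_inv (R : realType) (N : nat) (M : 'M[R]_N) :
  symform M -> M \in unitmx -> tensor_ge0 M -> tensor_ge0 (invmx M).
Proof.
move=> sM uM tM s G Y hG.
have := tM s G (fun i => invmx M *m Y i) hG.
by under eq_bigr do under eq_bigr do rewrite -bform_inv//.
Qed.

(* Substituting u = U_i - tau sum_j a_ij F_j in the expansion of the left-hand
   side produces the algebraic stability matrix. *)
Lemma rk_energy (R : realType) (s N : nat) (rk : rk_method R s) (K : 'M[R]_N)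
    (tau : R) (u : 'cV[R]_N) (F U : 'I_s.+1 -> 'cV[R]_N) :
  algebraically_stable rk -> symform K -> tensor_ge0 K ->
  (forall i, U i = u + tau *: \sum_j rk_a rk i j *: F j) ->
  qform K (u + tau *: \sum_i rk_b rk i *: F i)
  <= qform K u + 2 * tau * \sum_i rk_b rk i * bform K (F i) (U i).
Proof.
move=> [_ hst] sK tK hU.
pose X i j := bform K (F i) (F j).
have XC i j : X i j = X j i by exact: sK.
have := tK _ _ F hst.
under eq_bigr do under eq_bigr do rewrite mxE -/(X _ _) mulrBl mulrDl.
under eq_bigr do rewrite sumrB big_split/=.
rewrite sumrB big_split/=.
have -> : \sum_i \sum_j rk_b rk j * rk_a rk j i * X i j
    = \sum_i \sum_j rk_b rk i * rk_a rk i j * X i j.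
  rewrite exchange_big/=; apply: eq_bigr => i _; apply: eq_bigr => j _.
  by rewrite XC.
set S1 := \sum_i \sum_j _ * _ * X i j; set S2 := \sum_i \sum_j _ * _ * X i j.
move=> hS.
have -> : \sum_i rk_b rk i * bform K (F i) (U i)
    = \sum_i rk_b rk i * bform K u (F i) + tau * S1.
  rewrite mulr_sumr -big_split/=; apply: eq_bigr => i _.
  rewrite hU !bform_lin bform_sumr sK mulrDr; congr (_ + _).
  rewrite mulrCA; congr (_ * _); rewrite mulr_sumr; apply: eq_bigr => j _.
  by rewrite bformZr mulrA.
rewrite qformDE// qformZ bformZr bform_sumr.
have -> : \sum_i bform K u (rk_b rk i *: F i)
    = \sum_i rk_b rk i * bform K u (F i).
  by apply: eq_bigr => i _; rewrite bformZr.
have -> : qform K (\sum_i rk_b rk i *: F i) = S2.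
  rewrite /qform bform_suml; apply: eq_bigr => i _.
  rewrite bform_sumr; apply: eq_bigr => j _.
  by rewrite !bform_lin mulrA.
have := mulr_ge0 (sqr_ge0 tau) hS; set S := \sum_i _; lra.
Qed.

(** * Estimates of the stage errors *)

(** All that the energy argument uses about the three matrices at one time. For the finite element
    matrices [L] is a quarter of the squared velocity bound. *)
Record form_bounds (R : realType) (N : nat) (L : R) (M A B : 'M[R]_N) : Prop := {
  fb_Msym : symform M;
  fb_Mpos : posdef M;
  fb_Asym : symform A;
  fb_Age0 : forall z, 0 <= qform A z;
  fb_adv : forall (e : R) z y, 0 < e ->
    bform B z y <= e * qform A z + L / e * qform M y }.

Lemma fb_AM (R : realType) (N : nat) (L : R) (M A B : 'M[R]_N) :
  form_bounds L M A B -> symform (A + M) /\ posdef (A + M).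
Proof.
move=> [sM pM sA pA _]; split=> [x y|z z0].
  by rewrite !bform_mxD sA sM.
by rewrite qform_mxD ltr_wpDl// pM.
Qed.

Lemma fb_star_ge0 (R : realType) (N : nat) (L : R) (M A B : 'M[R]_N) w :
  form_bounds L M A B -> 0 <= qform (invmx (A + M)) w.
Proof. by move=> /fb_AM[s p]; exact: posdef_inv_ge0. Qed.

(** The stage equation expresses [F] by [E] and [w]; each of the three terms is paired with [- z]
    and estimated by Young's inequality with parameter 1. *)
Lemma stage_dual (R : realType) (N : nat) (L : R) (M A B : 'M[R]_N)
    (E F w z : 'cV[R]_N) : form_bounds L M A B ->
  0 = F + B *m E + A *m E + w ->
  bform 1%:M z F <= 3 * qform A z + qform M z + L * qform M E + qform A E
    + qform (invmx (A + M)) w.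
Proof.
move=> fb hF; have [sAM pAM] := fb_AM fb.
have -> : F = - (B *m E + A *m E + w).
  by apply/eqP; rewrite -addr_eq0 !addrA -hF.
rewrite -[bform _ _ _]opprK -bformNl bformNr opprK !bformDr !bform1_mul.
have h1 := fb_adv fb (- z) E ltr01.
have h2 := @bform_young _ _ A 1 (- z) E (fb_Asym fb) (fb_Age0 fb) ltr01.
have h3 := @dual_young _ _ (A + M) 1 (- z) w sAM pAM ltr01.
have h4 := fb_star_ge0 w fb; have h5 := fb_Age0 fb E.
rewrite mulr1 !qform_mxD !qformN in h1 h2 h3.
rewrite divr1 in h1.
have i4 : (4:R)^-1 <= 1 by rewrite invf_le1 ?ler1n.
have := ler_wpM2r h4 i4; have := ler_wpM2r h5 i4; lra.
Qed.

(** Pairing [F] with [E + D] produces the dissipation [- qform A E], half of which survives the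
    estimates of the remaining terms. *)
Lemma stage_energy (R : realType) (N : nat) (L : R) (M A B : 'M[R]_N)
    (E F D w : 'cV[R]_N) : 0 <= L -> form_bounds L M A B ->
  0 = F + B *m E + A *m E + w ->
  bform 1%:M F (E + D) <= - (2^-1 * qform A E)
    + (16 * L + 4) * (qform M E + (qform M D + qform A D)
                      + qform (invmx (A + M)) w).
Proof.
move=> L0 fb hF; have [sAM pAM] := fb_AM fb.
have -> : F = - (B *m E + A *m E + w).
  by apply/eqP; rewrite -addr_eq0 !addrA -hF.
rewrite bformNl bform1C -bformNr -scaleN1r bformZr -bformZl scaleN1r.
rewrite !bformDr !bform1_mul.
(* With 1/16 the advection term and the [w] term cost 1/8 of [qform A E] each; together with the 1/4
   lost in the mixed term [- bform A D E] they leave the coefficient -1/2. *)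
have e0 : 0 < 16^-1 :> R by rewrite invr_gt0.
have h1 := fb_adv fb (- (E + D)) E e0.
have h2 : bform A (- (E + D)) E <= - (3 / 4 * qform A E) + qform A D.
  have h : 0 < 1 :> R by [].
  have := @bform_young _ _ A 1 (- D) E (fb_Asym fb) (fb_Age0 fb) h.
  rewrite !bform_lin qformN mulr1 -/(qform A E); lra.
have h3 := @dual_young _ _ (A + M) 16^-1 (- (E + D)) w sAM pAM e0.
have h4 := fb_star_ge0 w fb.
rewrite !qform_mxD !qformN invrK in h1 h3.
have h5 := qformD_le E D (fb_Asym fb) (fb_Age0 fb).
have h6 := qformD_le E D (fb_Msym fb) (posdef_ge0 (fb_Mpos fb)).
have h7 := posdef_ge0 (fb_Mpos fb) E.
have h8 := posdef_ge0 (fb_Mpos fb) D.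
have h9 := fb_Age0 fb D; have h10 := fb_Age0 fb E.
have e4 : (4 * 16^-1)^-1 = 4 :> R by field.
rewrite e4 in h3.
have := mulr_ge0 L0 h8; have := mulr_ge0 L0 h9; have := mulr_ge0 L0 h4.
have := mulr_ge0 L0 h7.
lra.
Qed.

Lemma ler_term_sum (R : realType) (n : nat) (f : 'I_n -> R) i :
  (forall j, 0 <= f j) -> f i <= \sum_j f j.
Proof.
by move=> f0; rewrite (bigD1 i)//= lerDl; apply: sumr_ge0 => j _.
Qed.

(** The stage equation is tested with [E i]; the terms with [F j] carry the factor [tau], so for
    small [tau] their share of the M-norms of the stages is absorbed on the left. *)
Lemma stage_bound (R : realType) (s N : nat) (rk : rk_method R s) (L tau : R)
    (M0 : 'M[R]_N) (M A B : 'I_s.+1 -> 'M[R]_N) (u : 'cV[R]_N)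
    (E F D w : 'I_s.+1 -> 'cV[R]_N) :
  let alpha := \sum_i \sum_j `|rk_a rk i j| in
  0 <= L -> 0 <= tau -> tau * alpha * (L + 2) <= 4^-1 ->
  (forall i, form_bounds L (M i) (A i) (B i)) ->
  (forall i z, qform (invmx (M i)) z <= 2 * qform (invmx M0) z) ->
  (forall i j z, qform (M j) z <= 2 * qform (M i) z) ->
  (forall i j z, qform (A j) z <= 2 * qform (A i) z) ->
  (forall i, M i *m (E i + D i) = u + tau *: \sum_j rk_a rk i j *: F j) ->
  (forall i, 0 = F i + B i *m E i + A i *m E i + w i) ->
  \sum_i qform (M i) (E i)
  <= 8 * s.+1%:R * qform (invmx M0) u + 4 * \sum_i qform (M i) (D i)
     + 2 * (tau * alpha) * (7 * \sum_i qform (A i) (E i)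
                         + \sum_i qform (invmx (A i + M i)) (w i)).
Proof.
move=> alpha L0 t0 tL fb hK hM hA hU hF.
set mm := \sum_i qform (M i) (E i); set am := \sum_i qform (A i) (E i).
set rm := \sum_i qform (invmx _) (w i); set dm := \sum_i qform (M i) (D i).
set x := qform (invmx M0) u.
have m0 i z : 0 <= qform (M i) z by exact: posdef_ge0 (fb_Mpos (fb i)) z.
have a0 i z : 0 <= qform (A i) z by exact: fb_Age0 (fb i) z.
have r0 i : 0 <= qform (invmx (A i + M i)) (w i) by exact: fb_star_ge0 (fb i).
have mi i : qform (M i) (E i) <= mm by exact: (ler_term_sum i (fun j => m0 j (E j))).
have ai i : qform (A i) (E i) <= am by exact: (ler_term_sum i (fun j => a0 j (E j))).
have ri i : qform (invmx (A i + M i)) (w i) <= rm by exact: (ler_term_sum i r0).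
(* Moving [E i] from time [j] to time [i] costs a factor 2. Thus 7 = 3 * 2 + 1 collects the A-terms
   of [stage_dual] and [L + 2] its M-terms. *)
pose Z := 7 * am + (L + 2) * mm + rm.
have hZ i j : `|bform 1%:M (E i) (F j)| <= Z.
  (* Only the quadratic values of [z] enter, so the bound applies to [E i] and to [- E i], which
     gives the absolute value. *)
  have h z : qform (M j) z = qform (M j) (E i) -> qform (A j) z = qform (A j) (E i) ->
      bform 1%:M z (F j) <= Z.
    move=> hz1 hz2; have := stage_dual z (fb j) (hF j).
    rewrite hz1 hz2; have := hM i j (E i); have := hA i j (E i).
    have := mi i; have := ai i; have := ri j; have := ai j.
    have := ler_wpM2l L0 (mi j); rewrite /Z; lra.
  rewrite ler_norml lerNl -bformNl !h ?qformN//.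
have step i : qform (M i) (E i) <= 4^-1 * qform (M i) (E i) + 4 * x
    + 2 * qform (M i) (D i) + tau * (\sum_j `|rk_a rk i j|) * Z.
  have e0 : 0 < 8^-1 :> R by rewrite invr_gt0.
  have e8 : (4 * 8^-1)^-1 = 2 :> R by field.
  have [sM pM] := (fb_Msym (fb i), fb_Mpos (fb i)).
  have h1 := @dual_young _ _ (M i) 8^-1 (E i) u sM pM e0.
  have h2 := @bform_young _ _ (M i) 8^-1 (E i) (- D i) sM (m0 i) e0.
  rewrite e8 qformN in h2; rewrite e8 in h1.
  have h3 : tau * bform 1%:M (E i) (\sum_j rk_a rk i j *: F j)
      <= tau * (\sum_j `|rk_a rk i j|) * Z.
    rewrite -mulrA; apply: ler_wpM2l => //; rewrite bform_sumr mulr_suml.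
    apply: ler_sum => j _; rewrite bformZr; apply: le_trans (ler_norm _) _.
    by rewrite normrM; apply: ler_wpM2l.
  have h4 : qform (M i) (E i) = bform 1%:M (E i) u
      + tau * bform 1%:M (E i) (\sum_j rk_a rk i j *: F j) + bform (M i) (E i) (- D i).
    rewrite -bformZr -bformDr -hU bform1_mul !bform_lin /qform; lra.
  have := hK i u; rewrite -/x; lra.
have h : mm <= \sum_i (4^-1 * qform (M i) (E i) + 4 * x
    + 2 * qform (M i) (D i) + tau * (\sum_j `|rk_a rk i j|) * Z).
  by apply: ler_sum => i _.
have e : \sum_i (4^-1 * qform (M i) (E i) + 4 * x
    + 2 * qform (M i) (D i) + tau * (\sum_j `|rk_a rk i j|) * Z)
    = 4^-1 * mm + s.+1%:R * (4 * x) + 2 * dm + tau * alpha * Z.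
  rewrite !big_split/= -!mulr_sumr -mulr_suml -mulr_sumr sumr_const card_ord.
  by rewrite -[x *+ s.+1]mulr_natl mulrCA.
rewrite {}e in h.
(* One quarter of [mm] comes from Young's inequality and one quarter from the step size condition;
   half of [mm] remains on the left. *)
have Z0 : 0 <= mm by apply: sumr_ge0 => i _.
have := ler_wpM2r Z0 tL; move: h; rewrite /Z; lra.
Qed.

Ltac nonneg :=
  by repeat first [done | assumption | exact: ltW | apply: mulr_ge0 | apply: addr_ge0].

(** Inverting the coefficient matrix in the stage equations recovers [tau *: F i] from stage values,
    without a negative power of [tau]. *)
Lemma stage_increment (R : realType) (s N : nat) (rk : rk_method R s) (tau : R)
    (u : 'cV[R]_N) (F U : 'I_s.+1 -> 'cV[R]_N) (i : 'I_s.+1) :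
  rk_a rk \in unitmx ->
  (forall j, U j = u + tau *: \sum_k rk_a rk j k *: F k) ->
  tau *: F i = \sum_j invmx (rk_a rk) i j *: (U j - u).
Proof.
move=> ua hU.
have -> : \sum_j invmx (rk_a rk) i j *: (U j - u)
    = tau *: \sum_k (invmx (rk_a rk) *m rk_a rk) i k *: F k.
  under [in RHS]eq_bigr do rewrite mxE scaler_suml.
  rewrite exchange_big/= scaler_sumr; apply: eq_bigr => j _.
  rewrite hU addrC addKr scalerA mulrC -scalerA; congr (_ *: _).
  by rewrite scaler_sumr; apply: eq_bigr => k _; rewrite scalerA.
rewrite mulVmx// (bigD1 i)//= mxE eqxx scale1r big1 ?addr0// => k ki.
by rewrite mxE eq_sym (negPf ki) scale0r.
Qed.

Lemma stage_increment_bound (R : realType) (s N : nat) (rk : rk_method R s)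
    (tau : R) (K : 'M[R]_N) (u : 'cV[R]_N) (F U : 'I_s.+1 -> 'cV[R]_N)
    (i : 'I_s.+1) :
  rk_a rk \in unitmx -> symform K -> (forall z, 0 <= qform K z) ->
  (forall j, U j = u + tau *: \sum_k rk_a rk j k *: F k) ->
  qform K (tau *: F i)
  <= 2 * (s.+1%:R * \sum_i \sum_j invmx (rk_a rk) i j ^+ 2)
     * (\sum_j qform K (U j) + qform K u).
Proof.
move=> ua sK pK hU; rewrite (stage_increment i ua hU).
apply: le_trans (qform_sum_le _ sK pK) _.
rewrite -!mulrA mulrCA; apply: ler_wpM2l => //.
set W := \sum_j qform K (U j) + qform K u.
have W0 : 0 <= W by rewrite addr_ge0// sumr_ge0.
apply: (@le_trans _ _ (\sum_j invmx (rk_a rk) i j ^+ 2 * (2 * W))).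
  apply: ler_sum => j _; rewrite qformZ; apply: ler_wpM2l; first exact: sqr_ge0.
  have := qformD_le (U j) (- u) sK pK; rewrite qformN => /le_trans; apply.
  rewrite -mulrDr; apply: ler_wpM2l => //; rewrite lerD2r.
  exact: (ler_term_sum j (fun j => pK (U j))).
rewrite -mulr_suml [2 * (_ * _)]mulrCA; apply: ler_wpM2r; first by rewrite mulr_ge0.
apply: (ler_term_sum i) => k; apply: sumr_ge0 => j _; exact: sqr_ge0.
Qed.

(** The reciprocal of one plus the sum of all [1 / b_i] lies below 1 and below every weight. *)
Lemma rk_b_lower (R : realType) (s : nat) (rk : rk_method R s) :
  algebraically_stable rk ->
  exists beta, [/\ 0 < beta, beta <= 1 & forall i, beta <= rk_b rk i].
Proof.
move=> [hb _].
have h i : 0 < (rk_b rk i)^-1 by rewrite invr_gt0.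
have S0 : 0 <= \sum_i (rk_b rk i)^-1 by apply: sumr_ge0 => i _; exact/ltW.
have S1 : 0 < 1 + \sum_i (rk_b rk i)^-1 by lra.
exists (1 + \sum_i (rk_b rk i)^-1)^-1; split=> [||i].
- by rewrite invr_gt0.
- by rewrite invf_le1// lerDl.
- rewrite -[leRHS]invrK lef_pV2 ?posrE//.
  have := ler_term_sum i (fun j => ltW (h j)); lra.
Qed.

(** The constants are chosen before the dimension and the matrices, which yields independence of the
    mesh. The energy inequality is taken in the form of [invmx M0], its right-hand side is estimated
    by [stage_energy], and the stage norms are then eliminated by [stage_bound]. *)
Lemma rk_step (R : realType) (s : nat) (rk : rk_method R s) (L g : R) :
  rk_a rk \in unitmx -> algebraically_stable rk -> 0 <= L -> 0 <= g ->
  exists tau1 C beta, [/\ [/\ 0 < tau1, tau1 <= 1, 0 <= C, 0 < beta & beta <= 1] &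
  forall (N : nat) (tau : R) (M0 : 'M[R]_N) (M A B : 'I_s.+1 -> 'M[R]_N)
    (u : 'cV[R]_N) (E F D w : 'I_s.+1 -> 'cV[R]_N),
  0 < tau -> tau <= tau1 -> symform M0 -> posdef M0 -> tensor_ge0 M0 ->
  (forall i, form_bounds L (M i) (A i) (B i)) ->
  (forall i z y, `|bform (invmx (M i) - invmx M0) z y|
     <= g * tau * (qform (invmx M0) z + qform (invmx M0) y)) ->
  (forall i z, qform (invmx M0) z <= 2 * qform (invmx (M i)) z) ->
  (forall i z, qform (invmx (M i)) z <= 2 * qform (invmx M0) z) ->
  (forall i j z, qform (M j) z <= 2 * qform (M i) z) ->
  (forall i j z, qform (A j) z <= 2 * qform (A i) z) ->
  (forall i, M i *m (E i + D i) = u + tau *: \sum_j rk_a rk i j *: F j) ->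
  (forall i, 0 = F i + B i *m E i + A i *m E i + w i) ->
  qform (invmx M0) (u + tau *: \sum_i rk_b rk i *: F i)
    + beta * tau * \sum_i qform (A i) (E i)
  <= (1 + C * tau) * qform (invmx M0) u
     + C * tau * \sum_i (qform (invmx (A i + M i)) (w i)
        + (qform (M i) (D i) + qform (A i) (D i)))].
Proof.
move=> ua hst L0 g0; have [b0 _] := hst.
have [beta [beta0 beta1 hbeta]] := rk_b_lower hst.
pose alpha := \sum_i \sum_j `|rk_a rk i j|.
have al0 : 0 <= alpha by apply: sumr_ge0 => i _; apply: sumr_ge0.
pose kap := 2 * (s.+1%:R * \sum_i \sum_j invmx (rk_a rk) i j ^+ 2).
have kap0 : 0 <= kap.
  rewrite /kap !mulr_ge0//; apply: sumr_ge0 => i _; apply: sumr_ge0 => j _.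
  exact: sqr_ge0.
pose bs := \sum_i rk_b rk i.
have bs0 : 0 <= bs by apply: sumr_ge0 => i _; exact/ltW.
(* [C2 * tau] bounds the total coefficient of the stage M-norms: one part from [stage_energy], one
   from replacing [invmx M0] by the inverse at the stage. *)
pose C2 := 2 * bs * (16 * L + 4 + g * (4 * (kap + 1))).
have C20 : 0 <= C2 by nonneg.
(* [tau * k1 <= 1] is the smallness required by [stage_bound]; [tau * k2 <= beta] lets half of the
   dissipation absorb the A-norms that [stage_bound] reintroduces, which explains [beta / 2]. Adding
   1 keeps both divisors positive. *)
pose k1 := 4 * (alpha * (L + 2)) + 1.
have k10 : 0 < k1 by apply: ltr_wpDl => //; nonneg.
pose k2 := 28 * (C2 * alpha) + 1.
have k20 : 0 < k2 by apply: ltr_wpDl => //; nonneg.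
exists (Num.min 1 (Num.min k1^-1 (beta / k2))).
exists (2 * bs * g * kap + 8 * s.+1%:R * C2 + C2 * (5 + 2 * alpha)), (beta / 2).
split.
  split.
  - by rewrite !lt_min ltr01 invr_gt0 k10 divr_gt0.
  - by rewrite ge_min lexx.
  - nonneg.
  - by rewrite divr_gt0.
  - lra.
move=> N tau M0 M A B u E F D w t0.
rewrite !le_min => /and3P[t1 tk1 tk2] sM0 pM0 tM0 fb hK hK0 hKi hM hA hU hF.
have {}tk1 : tau * k1 <= 1 by rewrite -ler_pdivlMr// div1r.
have {}tk2 : tau * k2 <= beta by rewrite -ler_pdivlMr.
have uM0 := posdef_unitmx pM0.
have sK0 := symform_inv sM0.
have pK0 := posdef_inv_ge0 sM0 pM0.
set x := qform (invmx M0) u.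
have x0 : 0 <= x := pK0 u.
have m0 i z : 0 <= qform (M i) z by exact: posdef_ge0 (fb_Mpos (fb i)) z.
have a0 i z : 0 <= qform (A i) z by exact: fb_Age0 (fb i) z.
have r0 i : 0 <= qform (invmx (A i + M i)) (w i) by exact: fb_star_ge0 (fb i).
set am := \sum_i qform (A i) (E i).
pose mm := \sum_i qform (M i) (E i).
pose rm := \sum_i qform (invmx (A i + M i)) (w i).
pose dM := \sum_i qform (M i) (D i).
pose dA := \sum_i qform (A i) (D i).
have am0 : 0 <= am by apply: sumr_ge0 => i _.
have mm0 : 0 <= mm by apply: sumr_ge0 => i _.
have rm0 : 0 <= rm by apply: sumr_ge0 => i _.
have dM0 : 0 <= dM by apply: sumr_ge0 => i _.
have dA0 : 0 <= dA by apply: sumr_ge0 => i _.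
have -> : \sum_i (qform (invmx (A i + M i)) (w i)
    + (qform (M i) (D i) + qform (A i) (D i))) = rm + (dM + dA).
  by rewrite !big_split.
have hstage : mm <= 8 * s.+1%:R * x + 4 * dM + 2 * (tau * alpha) * (7 * am + rm).
  apply: (@stage_bound _ _ _ rk L tau M0 M A B u E F D w) => //; first exact: ltW.
  rewrite -/alpha -(ler_pM2l (_ : 0 < 4)) ?mulfV//.
  by move: tk1; rewrite /k1; lra.
have hUq i : qform (invmx M0) (M i *m (E i + D i))
    <= 4 * qform (M i) (E i) + 4 * qform (M i) (D i).
  have sMi := fb_Msym (fb i); have uMi := posdef_unitmx (fb_Mpos (fb i)).
  apply: le_trans (hK0 i _) _; rewrite qform_inv_mul//.
  have := qformD_le (E i) (D i) sMi (m0 i); lra.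
have hUs : \sum_i qform (invmx M0) (M i *m (E i + D i)) <= 4 * (mm + dM).
  rewrite /mm /dM -big_split mulr_sumr/=; apply: ler_sum => i _.
  by rewrite mulrDr.
(* The pairing in [invmx (M i)] is Euclidean and falls under [stage_energy]. The change to
   [invmx M0] costs [g * tau] times the forms of [tau *: F i] and of the stage value, both
   controlled by stage values and [u]. *)
have hpair i : tau * bform (invmx M0) (F i) (M i *m (E i + D i))
    <= tau * (- (2^-1 * qform (A i) (E i))
      + (16 * L + 4) * (qform (M i) (E i) + (qform (M i) (D i) + qform (A i) (D i))
                      + qform (invmx (A i + M i)) (w i)))
      + g * tau * (4 * (kap + 1) * (mm + dM) + kap * x).
  have uMi := posdef_unitmx (fb_Mpos (fb i)).
  have h1 := stage_energy (D i) L0 (fb i) (hF i).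
  rewrite -(bform_inv_mul _ _ uMi) in h1.
  have /(ler_wpM2l (ltW t0)) {}h1 := h1.
  have h2 := hK i (tau *: F i) (M i *m (E i + D i)).
  rewrite bform_mxB !bformZl ler_norml in h2; case/andP: h2 => h2 _.
  have h3 := stage_increment_bound i ua sK0 pK0 hU; rewrite -/kap -/x in h3.
  have h4 := ler_term_sum i (fun j => pK0 (M j *m (E j + D j))).
  have gt0 : 0 <= g * tau by rewrite mulr_ge0// ltW.
  have h5 : qform (invmx M0) (tau *: F i) + qform (invmx M0) (M i *m (E i + D i))
      <= 4 * (kap + 1) * (mm + dM) + kap * x.
    have := ler_wpM2l kap0 hUs; lra.
  have := ler_wpM2l gt0 h5; lra.
have := rk_energy hst sK0 (tensor_ge0_inv sM0 uM0 tM0) hU.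
rewrite -/x.
(* The weights are bounded below by [beta] in front of the dissipation and above by their sum [bs]
   elsewhere. *)
have hsum : tau * \sum_i rk_b rk i * bform (invmx M0) (F i) (M i *m (E i + D i))
    <= - (2^-1 * tau * beta * am)
       + tau * bs * (16 * L + 4) * (mm + (dM + dA) + rm)
       + bs * (g * tau * (4 * (kap + 1) * (mm + dM) + kap * x)).
  set Y := g * tau * _; pose c := 16 * L + 4.
  have c0 : 0 <= c by rewrite /c; lra.
  pose qi i := qform (M i) (E i) + (qform (M i) (D i) + qform (A i) (D i))
      + qform (invmx (A i + M i)) (w i).
  have qi0 i : 0 <= qi i by rewrite /qi !addr_ge0.
  apply: (@le_trans _ _ (\sum_i (- (2^-1 * tau * beta * qform (A i) (E i))
      + tau * bs * c * qi i + rk_b rk i * Y))).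
    rewrite mulr_sumr; apply: ler_sum => i _; rewrite mulrCA.
    apply: le_trans (ler_wpM2l (ltW (b0 i)) (hpair i)) _.
    rewrite -/Y -/c -/(qi i) mulrDr lerD2r mulrDr mulrDr; apply: lerD.
      have := ler_wpM2r (a0 i (E i)) (hbeta i); move=> /(ler_wpM2l (ltW t0)); lra.
    have : rk_b rk i * (tau * (c * qi i)) <= bs * (tau * (c * qi i)).
      apply: ler_wpM2r; first nonneg.
      by apply: (ler_term_sum i) => j; exact: ltW.
    lra.
  rewrite !big_split/= -mulr_suml -/bs sumrN -!mulr_sumr -/am.
  by rewrite /qi !big_split.
have hfin : C2 * tau * mm <= C2 * tau * (8 * s.+1%:R * x + 4 * dM)
    + 2^-1 * (beta * tau * am) + C2 * tau * (2 * alpha * rm).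
  have ct0 : 0 <= C2 * tau by rewrite mulr_ge0// ltW.
  apply: le_trans (ler_wpM2l ct0 hstage) _.
  have e1 : 28 * (C2 * alpha) * tau <= beta by move: tk2; rewrite /k2; lra.
  have e2 : 0 <= tau * am by rewrite mulr_ge0// ltW.
  have h1 := ler_wpM2r e2 e1.
  have e3 : 0 <= C2 * tau * (alpha * rm) by nonneg.
  have h2 := ler_wpM2r e3 t1.
  rewrite mul1r in h2; lra.
have hC2 : 2 * (tau * bs * (16 * L + 4) * (mm + (dM + dA) + rm))
    + 2 * (bs * (g * tau * (4 * (kap + 1) * (mm + dM) + kap * x)))
    <= C2 * tau * (mm + (dM + dA) + rm) + 2 * bs * g * kap * (tau * x).
  have : 0 <= bs * g * tau * (kap + 1) * (dA + rm).
    nonneg.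
  rewrite /C2; lra.
have hC3 : 0 <= C2 * tau * (dA + rm).
  nonneg.
have p1 : 0 <= bs * g * kap * tau by nonneg.
have p2 : 0 <= s.+1%:R * C2 * tau by nonneg.
have p3 : 0 <= C2 * alpha * tau by nonneg.
have d0 : 0 <= rm + (dM + dA) by rewrite !addr_ge0.
have := mulr_ge0 p1 d0; have := mulr_ge0 p2 d0.
have : 0 <= C2 * alpha * tau * (x + dM + dA) by rewrite mulr_ge0// !addr_ge0.
have : 0 <= C2 * tau * x by nonneg.
move: hsum hfin hC2 hC3; move: (C2) => c2.
move: (s.+1%:R) => S; move: (\sum_i rk_b rk i * _) => sg.
lra.
Qed.

(** * Variation in time and error propagation *)

(** The inequality [1 - x <= exp(-x)] multiplied by [exp x]. *)
Lemma expR_sub1_le (R : realType) (x : R) : expR x - 1 <= x * expR x.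
Proof.
have := expR_ge1Dx (- x); move=> /(ler_wpM2r (expR_ge0 x)).
rewrite expRN mulVf ?expR_eq0//; lra.
Qed.

(** A constant for which [exp(mu d) - 1 <= growth c mu * tau] whenever [0 <= d <= c tau] and
    [0 <= tau <= 1]; the absolute value admits either sign of [mu]. *)
Definition growth (R : realType) (c mu : R) : R := `|mu| * c * expR (`|mu| * c).

Lemma growth_ge0 (R : realType) (c mu : R) : 0 <= c -> 0 <= growth c mu.
Proof. by move=> c0; rewrite /growth !mulr_ge0// expR_ge0. Qed.

Lemma variation_bform (R : realType) (N : nat) (T mu c tau : R) (K : R -> 'M[R]_N)
    (s t : R) (z y : 'cV[R]_N) : variation_bound T mu K ->
  0 <= s <= T -> 0 <= t <= T -> (forall x, 0 <= qform (K t) x) ->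
  0 <= c -> 0 <= tau <= 1 -> `|s - t| <= c * tau ->
  `|bform (K s - K t) z y| <= growth c mu * tau * (qform (K t) z + qform (K t) y).
Proof.
move=> hv hs ht pK c0 /andP[t0 t1] hst.
have ct : c * tau <= c by rewrite ler_piMr.
have he : expR (mu * `|s - t|) - 1 <= growth c mu * tau.
  have h1 : mu * `|s - t| <= `|mu| * (c * tau).
    apply: (@le_trans _ _ (`|mu| * `|s - t|)).
      by apply: ler_wpM2r => //; exact: ler_norm.
    exact: ler_wpM2l.
  apply: (@le_trans _ _ (expR (`|mu| * (c * tau)) - 1)).
    by rewrite lerB// ler_expR.
  apply: le_trans (expR_sub1_le _) _; rewrite /growth.
  have -> : `|mu| * c * expR (`|mu| * c) * tau = `|mu| * (c * tau) * expR (`|mu| * c).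
    by ring.
  apply: ler_wpM2l; first by rewrite !mulr_ge0.
  by rewrite ler_expR; apply: ler_wpM2l.
have h x : mnorm (K t) x = mnorm (K t) z ->
    bform (K s - K t) x y <= growth c mu * tau * (qform (K t) z + qform (K t) y).
  move=> hx; apply: le_trans (hv _ _ _ _ hs ht) _; rewrite hx -mulrA.
  set p := mnorm _ _; set q := mnorm _ _.
  have p2 : p ^+ 2 = qform (K t) z by rewrite sqr_sqrtr.
  have q2 : q ^+ 2 = qform (K t) y by rewrite sqr_sqrtr.
  have p0 : 0 <= p := sqrtr_ge0 _; have q0 : 0 <= q := sqrtr_ge0 _.
  apply: (@le_trans _ _ (growth c mu * tau * (p * q))).
    by apply: ler_wpM2r => //; rewrite mulr_ge0.
  apply: ler_wpM2l; first by rewrite mulr_ge0// growth_ge0.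
  rewrite -p2 -q2; have := sqr_ge0 (p - q); have := mulr_ge0 p0 q0; lra.
rewrite ler_norml lerNl -bformNl !h//.
by rewrite /mnorm qformN.
Qed.

Lemma variation_qform (R : realType) (N : nat) (T mu c tau : R) (K : R -> 'M[R]_N)
    (s t : R) (z : 'cV[R]_N) : variation_bound T mu K ->
  0 <= s <= T -> 0 <= t <= T -> (forall x, 0 <= qform (K t) x) ->
  0 <= c -> 0 <= tau <= 1 -> `|s - t| <= c * tau ->
  qform (K s) z <= (1 + 2 * growth c mu * tau) * qform (K t) z.
Proof.
move=> hv hs ht pK c0 ht1 hst.
have := variation_bform z z hv hs ht pK c0 ht1 hst.
rewrite ler_norml bform_mxB => /andP[_]; rewrite -!/(qform _ z); lra.
Qed.

(** In the induction step the accumulated dissipation need not grow: since [q >= 1], it is bounded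
    by [q] times itself, and each new [d] by its multiple with the final power of [q]. *)
Lemma discrete_gronwall (R : realType) (q b : R) (x y d : nat -> R) (n : nat) :
  1 <= q -> (forall k, (k < n)%N -> 0 <= d k) ->
  (forall k, (k < n)%N -> 0 <= b * y k.+1) ->
  (forall k, (k < n)%N -> x k.+1 + b * y k.+1 <= q * x k + d k) ->
  x n + b * \sum_(0 <= k < n) y k.+1 <= q ^+ n * (x 0%N + \sum_(0 <= k < n) d k).
Proof.
move=> q1; elim: n => [|n IH] hd hy hs.
  by rewrite !big_geq// mulr0 !addr0 expr0 mul1r.
have {}IH : x n + b * \sum_(0 <= k < n) y k.+1
    <= q ^+ n * (x 0%N + \sum_(0 <= k < n) d k).
  by apply: IH => k kn; [apply: hd|apply: hy|apply: hs]; exact: ltnW.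
rewrite !big_nat_recr//= mulrDr exprS.
have hb : 0 <= b * \sum_(0 <= k < n) y k.+1.
  rewrite mulr_sumr big_nat_cond; apply: sumr_ge0 => k /andP[/andP[_ kn] _].
  exact: hy (ltnW kn).
have q0 : 0 <= q by lra.
have qn : 1 <= q * q ^+ n by rewrite -exprS exprn_ege1.
have h1 := hs n (ltnSn n); have h2 := ler_wpM2l q0 IH.
have h3 := ler_wpM2r (hd n (ltnSn n)) qn; have h4 := ler_wpM2r hb q1.
lra.
Qed.

(** With [d = tau y] the mixed term has the factor [tau], so removing a defect amplifies the form of
    [x] by [1 + tau] only. *)
Lemma qformB_le (R : realType) (N : nat) (K : 'M[R]_N) (tau : R) (x d : 'cV[R]_N) :
  symform K -> (forall z, 0 <= qform K z) -> 0 < tau -> tau <= 1 ->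
  qform K (x - d) <= (1 + tau) * qform K x + 2 * tau * qform K (tau^-1 *: d).
Proof.
move=> sK pK t0 t1; set y := tau^-1 *: d.
have hd : d = tau *: y by rewrite scalerA divff ?scale1r// gt_eqF.
clearbody y; rewrite {}hd.
have e2 : 0 < 2^-1 :> R by rewrite invr_gt0.
have := @bform_young _ _ K 2^-1 x (- y) sK pK e2.
have -> : (4 * 2^-1)^-1 = 2^-1 :> R by field.
rewrite qformDE// !qformN qformZ !bformNr bformZr => /(ler_wpM2l (ltW t0)).
have : tau ^+ 2 * qform K y <= tau * qform K y.
  by rewrite expr2 -mulrA ler_wpM2l ?(ltW t0)// ler_piMl.
lra.
Qed.

(** [Q0] stands for the new value before the step defect in the old norm, [Q1] for the same in the
    new norm, [Q2] for the value after the defect; [y] and [y'] are dissipation terms. [G] is the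
    product of the two amplification factors. *)
Lemma step_combine (R : realType) (tau g C x d q Q0 Q1 Q2 y y' : R) :
  0 <= tau -> tau <= 1 -> 0 <= g -> 2 * g * tau <= 1 -> 0 <= C ->
  0 <= x -> 0 <= d -> 0 <= q -> 0 <= y -> y' <= y ->
  Q0 + y <= (1 + C * tau) * x + C * tau * d ->
  Q1 <= (1 + 2 * g * tau) * Q0 -> Q2 <= (1 + tau) * Q1 + 2 * tau * q ->
  Q2 + y' <= (1 + ((1 + 4 * g) * (1 + C) + 5 * C + 2) * tau) * x
    + ((1 + 4 * g) * (1 + C) + 5 * C + 2) * tau * (d + q).
Proof.
move=> t0 t1 g0 gt C0 x0 d0 q0 y0 yy h0 h1 h2.
pose P := (1 + C * tau) * x + C * tau * d.
have gt0 : 0 <= g * tau by rewrite mulr_ge0.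
have Ct0 : 0 <= C * tau by rewrite mulr_ge0.
have P0 : 0 <= P by rewrite addr_ge0 ?mulr_ge0 ?addr_ge0.
pose G := (1 + tau) * (1 + 2 * g * tau).
have G1 : 1 <= G by rewrite /G; have := mulr_ge0 t0 gt0; lra.
have GE : G <= 1 + tau * (1 + 4 * g).
  by rewrite /G; have := ler_wpM2l gt0 t1; lra.
have G4 : G <= 4.
  by rewrite /G; have := ler_wpM2l t0 gt; lra.
have s1 : Q2 + y' <= G * P + 2 * tau * q.
  have a1 : 0 <= 1 + tau by lra.
  have a2 := ler_wpM2l a1 h1.
  have G0 : 0 <= G by lra.
  have a3 := ler_wpM2l G0 h0.
  have a4 := ler_wpM2r y0 G1.
  rewrite -/P in a3; move: a2 a3 a4; rewrite /G; lra.
have s2 : G * ((1 + C * tau) * x)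
    <= (1 + ((1 + 4 * g) * (1 + C) + 5 * C) * tau) * x.
  rewrite mulrA; apply: ler_wpM2r => //.
  have b1 : 0 <= 1 + C * tau by lra.
  have := ler_wpM2r b1 GE; have := ler_wpM2l Ct0 t1.
  have := ler_wpM2l (mulr_ge0 gt0 C0) t1; have := mulr_ge0 gt0 C0; lra.
have s3 : G * (C * tau * d) <= 4 * (C * tau * d).
  by apply: ler_wpM2r => //; rewrite mulr_ge0.
have s4 : 0 <= tau * x by rewrite mulr_ge0.
have s5 : 0 <= tau * (d + q) by rewrite mulr_ge0 ?addr_ge0.
have s6 := mulr_ge0 C0 s5; have s7 := mulr_ge0 g0 s5.
have s8 := mulr_ge0 g0 s6; have s9 : 0 <= C * (tau * q) by rewrite !mulr_ge0.
have s10 : 0 <= tau * d by rewrite mulr_ge0.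
move: s1; rewrite /P mulrDr; lra.
Qed.

(** Subtracting the perturbed equations from the scheme gives a system of the form treated by
    [rk_step]; the norm is then moved from one time level to the next and the step defect
    removed. *)
Lemma rk_error_step (R : realType) (s : nat) (rk : rk_method R s)
    (L mu kappa : R) :
  rk_a rk \in unitmx -> algebraically_stable rk -> stiffly_accurate rk -> 0 <= L ->
  exists tau0 C beta, [/\ [/\ 0 < tau0, 0 <= C, 0 < beta & beta <= 1] &
  forall (T : R) (N : nat) (M A B : R -> 'M[R]_N),
  (forall t : R, 0 <= t <= T -> form_bounds L (M t) (A t) (B t)) ->
  (forall t : R, 0 <= t <= T -> tensor_ge0 (M t)) ->
  variation_bound T mu M -> variation_bound T mu (fun t => invmx (M t)) ->
  variation_bound T kappa A ->
  forall (tau : R) (n : nat), 0 < tau -> tau <= tau0 -> tn tau n <= T ->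
  (forall k i, (k < n)%N -> 0 <= tst rk tau k i <= T) ->
  forall (al : nat -> 'cV[R]_N) (st dst : nat -> 'I_s.+1 -> 'cV[R]_N),
  rk_solution rk tau M A B n al st dst ->
  forall (r ta dta : R -> 'cV[R]_N), perturbed_solution M A B T r ta dta ->
  let e := fun k => al k - ta (tn tau k) in
  let t_ := tst rk tau in
  let Delta := stage_defect rk tau M ta dta in
  let delta := step_defect rk tau M ta dta in
  forall k, (k < n)%N ->
  qform (M (tn tau k.+1)) (e k.+1)
    + beta * tau * qform (A (tn tau k.+1)) (e k.+1)
  <= (1 + C * tau) * qform (M (tn tau k)) (e k)
     + C * tau * (\sum_i (qform (invmx (A (t_ k i) + M (t_ k i)))
                           (M (t_ k i) *m r (t_ k i))
        + (qform (M (t_ k i)) (invmx (M (t_ k i)) *m Delta k i)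
           + qform (A (t_ k i)) (invmx (M (t_ k i)) *m Delta k i)))
       + qform (invmx (M (tn tau k.+1))) (tau^-1 *: delta k.+1))].
Proof.
move=> ua hst [hba hc1] L0.
(* Any two stage times of a step, and a stage time and the start of the step, differ by at most
   [cc * tau]. *)
pose cc := 2 * \sum_i `|rk_c rk i| + 1.
have cc1 : 1 <= cc by rewrite lerDr mulr_ge0// sumr_ge0.
have cc0 : 0 <= cc by lra.
pose gM := growth cc mu; pose gA := growth cc kappa.
have gM0 : 0 <= gM by exact: growth_ge0.
have gA0 : 0 <= gA by exact: growth_ge0.
have [tau1 [C [beta [[tau10 tau11 C0 beta0 beta1] hstep]]]] := rk_step ua hst L0 gM0.
(* [tau * g2 <= 1] keeps the variation of all three norms within a step below a factor 2. *)
pose g2 := 2 * (gM + gA) + 1.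
have g20 : 0 < g2 by rewrite /g2; lra.
pose C1 := (1 + 4 * gM) * (1 + C) + 5 * C + 2.
exists (Num.min tau1 g2^-1), C1, beta.
split; first split => //.
- by rewrite lt_min tau10 invr_gt0.
- by rewrite /C1 !addr_ge0 ?mulr_ge0// ?addr_ge0 ?mulr_ge0.
move=> T N M A B fb tM vM vK vA tau n t0; rewrite le_min => /andP[tt1 tg].
move=> nT tT al st dst hrk r ta dta hpert e t_ Delta delta k kn.
have t1 : tau <= 1 by lra.
have ht1 : 0 <= tau <= 1 by rewrite ltW.
have {}tg : tau * g2 <= 1 by rewrite -ler_pdivlMr// div1r.
have gMt : 2 * gM * tau <= 1.
  have := mulr_ge0 (ltW t0) gA0; move: tg; rewrite /g2; lra.
have gAt : 2 * gA * tau <= 1.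
  have := mulr_ge0 (ltW t0) gM0; move: tg; rewrite /g2; lra.
have tn_in j : (j <= n)%N -> 0 <= tn tau j <= T.
  move=> jn; rewrite /tn mulr_ge0 ?(ltW t0)//=; apply: le_trans nT.
  by rewrite /tn ler_wpM2r ?(ltW t0)// ler_nat.
have hk := tn_in _ (ltnW kn); have hk1 := tn_in _ kn.
have hki i : 0 <= t_ k i <= T := tT k i kn.
have ci i : `|rk_c rk i| <= \sum_i `|rk_c rk i| by apply: (ler_term_sum i).
have d0 i : `|t_ k i - tn tau k| <= cc * tau.
  rewrite /t_ /tst addrC addKr normrM (gtr0_norm t0) ler_wpM2r ?(ltW t0)//.
  by have := ci i; have := normr_ge0 (rk_c rk i); rewrite /cc; lra.
have d0' i : `|tn tau k - t_ k i| <= cc * tau by rewrite distrC.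
have dd i j : `|t_ k i - t_ k j| <= cc * tau.
  rewrite /t_ /tst opprD addrACA subrr add0r -mulrBl normrM (gtr0_norm t0).
  rewrite ler_wpM2r ?(ltW t0)//; apply: le_trans (ler_normB _ _) _.
  by have := ci i; have := ci j; rewrite /cc; lra.
have le2 g x : 0 <= x -> 2 * g * tau <= 1 -> (1 + 2 * g * tau) * x <= 2 * x.
  by move=> x0 hg; apply: ler_wpM2r => //; lra.
have M0 t z : 0 <= t <= T -> 0 <= qform (M t) z.
  by move=> /fb fbt; exact: posdef_ge0 (fb_Mpos fbt) z.
have A0 t z : 0 <= t <= T -> 0 <= qform (A t) z.
  by move=> /fb fbt; exact: fb_Age0 fbt z.
have K0 t z : 0 <= t <= T -> 0 <= qform (invmx (M t)) z.
  by move=> /fb fbt; exact: posdef_inv_ge0 (fb_Msym fbt) (fb_Mpos fbt) z.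
have uM t : 0 <= t <= T -> M t \in unitmx.
  by move=> /fb fbt; exact: posdef_unitmx (fb_Mpos fbt).
have M2 a b z : 0 <= a <= T -> 0 <= b <= T -> `|a - b| <= cc * tau ->
    qform (M a) z <= 2 * qform (M b) z.
  move=> ha hb hab; apply: le_trans (le2 _ _ (M0 b z hb) gMt).
  by apply: (variation_qform z vM) => // x; exact: M0.
have A2 a b z : 0 <= a <= T -> 0 <= b <= T -> `|a - b| <= cc * tau ->
    qform (A a) z <= 2 * qform (A b) z.
  move=> ha hb hab; apply: le_trans (le2 _ _ (A0 b z hb) gAt).
  by apply: (variation_qform z vA) => // x; exact: A0.
have K1 a b z : 0 <= a <= T -> 0 <= b <= T -> `|a - b| <= cc * tau ->
    qform (invmx (M a)) z <= (1 + 2 * gM * tau) * qform (invmx (M b)) z.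
  by move=> ha hb hab; apply: (variation_qform z vK) => // x; exact: K0.
have K2 a b z : 0 <= a <= T -> 0 <= b <= T -> `|a - b| <= cc * tau ->
    qform (invmx (M a)) z <= 2 * qform (invmx (M b)) z.
  by move=> ha hb hab; apply: le_trans (le2 _ _ (K0 b z hb) gMt); exact: K1.
have [rk1 rk2 rk3] := hrk k kn.
have tlast : t_ k ord_max = tn tau k.+1.
  by rewrite /t_ /tst hc1 /tn -[k.+1]addn1 natrD mulrDl.
pose u := M (tn tau k) *m e k.
pose E i := st k i - ta (t_ k i).
pose F i := dst k i - dta (t_ k i).
pose D i := invmx (M (t_ k i)) *m Delta k i.
pose w i := M (t_ k i) *m r (t_ k i).
(* The defect is moved to the left as [M D], so that the stage errors satisfy unperturbed
   Runge-Kutta relations for [E + D]. *)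
have hU i : M (t_ k i) *m (E i + D i) = u + tau *: \sum_j rk_a rk i j *: F j.
  rewrite mulmxDr mulKVmx ?uM// /E mulmxBr rk1 /Delta /stage_defect /u mulmxBr.
  rewrite -/(t_ k i); have -> : \sum_j rk_a rk i j *: F j
      = \sum_j rk_a rk i j *: dst k j - \sum_j rk_a rk i j *: dta (t_ k j).
    by rewrite -sumrB; apply: eq_bigr => j _; rewrite scalerBr.
  rewrite scalerBr; set a1 := M _ *m al k; set a2 := M _ *m ta _.
  set a3 := M _ *m ta _; set b1 := tau *: _; set b2 := tau *: _.
  by apply/matrixP => p q; rewrite !mxE; ring.
(* The perturbed equation at the stage time is subtracted; its right-hand side [M r] remains as
   [w]. *)
have hF i : 0 = F i + B (t_ k i) *m E i + A (t_ k i) *m E i + w i.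
  have [_ hp] := hpert _ (hki i); rewrite /w -hp /F /E !mulmxBr.
  have := rk3 i; rewrite -/(t_ k i); set a1 := B _ *m st _ _; set a2 := A _ *m st _ _.
  move=> h; rewrite h; set b1 := B _ *m _; set b2 := A _ *m _.
  by apply/matrixP => p q; rewrite !mxE; ring.
have fbk := fb _ hk.
have := hstep N tau (M (tn tau k)) (fun i => M (t_ k i)) (fun i => A (t_ k i))
  (fun i => B (t_ k i)) u E F D w t0 tt1 (fb_Msym fbk) (fb_Mpos fbk) (tM _ hk).
have vb i z y : `|bform (invmx (M (t_ k i)) - invmx (M (tn tau k))) z y|
    <= gM * tau * (qform (invmx (M (tn tau k))) z + qform (invmx (M (tn tau k))) y).
  by apply: (variation_bform z y vK) => // x; exact: K0.
move=> /(_ (fun i => fb _ (hki i)) vb).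
move=> /(_ (fun i z => K2 _ _ z hk (hki i) (d0' i))).
move=> /(_ (fun i z => K2 _ _ z (hki i) hk (d0 i))).
move=> /(_ (fun i j z => M2 _ _ z (hki j) (hki i) (dd j i))).
move=> /(_ (fun i j z => A2 _ _ z (hki j) (hki i) (dd j i))).
move=> /(_ hU hF).
set up := u + tau *: _; set am := \sum_i _; set dm := \sum_i _.
have -> : qform (invmx (M (tn tau k))) u = qform (M (tn tau k)) (e k).
  by rewrite qform_inv_mul ?uM//; exact: fb_Msym fbk.
set x := qform _ (e k) => hmain.
have hup : M (tn tau k.+1) *m e k.+1 = up - delta k.+1.
  rewrite /e mulmxBr rk2 /delta /step_defect /up /u mulmxBr /=.
  have -> : \sum_i rk_b rk i *: F i
      = \sum_i rk_b rk i *: dst k i - \sum_i rk_b rk i *: dta (t_ k i).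
    by rewrite -sumrB; apply: eq_bigr => j _; rewrite scalerBr.
  rewrite scalerBr -/t_; set a1 := M _ *m al k; set a2 := M _ *m ta _.
  set a3 := M _ *m ta _; set b1 := tau *: _; set b2 := tau *: _.
  by apply/matrixP => p q; rewrite !mxE; ring.
(* Stiff accuracy: the last stage and the step satisfy the same equation at the same time, so the
   new error is the last stage error and its A-norm is one term of [am]. *)
have hlast : e k.+1 = E ord_max.
  rewrite /e /E tlast; congr (_ - _); apply: (can_inj (mulKmx (uM _ hk1))).
  rewrite rk2 -tlast rk1; congr (_ + _ *: _).
  by apply: eq_bigr => j _; rewrite hba.
have hA1 : qform (A (tn tau k.+1)) (e k.+1) <= am.
  rewrite hlast -tlast.
  by apply: (ler_term_sum ord_max (fun i => A0 _ (E i) (hki i))).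
have fbk1 := fb _ hk1.
have -> : qform (M (tn tau k.+1)) (e k.+1)
    = qform (invmx (M (tn tau k.+1))) (up - delta k.+1).
  by rewrite -hup qform_inv_mul ?uM//; exact: fb_Msym fbk1.
have h1 : qform (invmx (M (tn tau k.+1))) up
    <= (1 + 2 * gM * tau) * qform (invmx (M (tn tau k))) up.
  by apply: K1 => //; rewrite -tlast.
have sK1 := symform_inv (fb_Msym fbk1).
have pK1 := posdef_inv_ge0 (fb_Msym fbk1) (fb_Mpos fbk1).
have h2 := qformB_le up (delta k.+1) sK1 pK1 t0 t1.
have am0 : 0 <= am by apply: sumr_ge0 => i _; exact: A0.
have dm0 : 0 <= dm.
  apply: sumr_ge0 => i _; apply: addr_ge0; first exact: fb_star_ge0 (fb _ (hki i)).
  by apply: addr_ge0; [exact: M0|exact: A0].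
have bt0 : 0 <= beta * tau by rewrite mulr_ge0// ltW.
apply: step_combine hmain h1 h2 => //.
- exact: ltW.
- exact: M0.
- exact: mulr_ge0.
- exact: ler_wpM2l.
Qed.

Lemma gronwall_factor_le (R : realType) (C tau T : R) (n : nat) :
  0 <= C -> 0 <= tau -> n%:R * tau <= T -> (1 + C * tau) ^+ n <= expR (C * T).
Proof.
move=> C0 t0 nT; apply: (@le_trans _ _ (expR (C * tau) ^+ n)).
  rewrite lerXn2r ?nnegrE ?expR_ge0 ?expR_ge1Dx//.
  by rewrite addr_ge0 ?mulr_ge0.
by rewrite -expRM_natl ler_expR mulrCA ler_wpM2l.
Qed.

(** The error estimate for abstract matrices. [tau0] and [C] are parameters fixed before the final
    time, the dimension and the matrices; only [C] is evaluated at the final time. *)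
Definition rk_error_bound (R : realType) (s : nat) (rk : rk_method R s)
    (L mu kappa tau0 : R) (C : R -> R) : Prop :=
  forall (T : R) (N : nat) (M A B : R -> 'M[R]_N), 0 < T ->
  (forall t : R, 0 <= t <= T -> form_bounds L (M t) (A t) (B t)) ->
  (forall t : R, 0 <= t <= T -> tensor_ge0 (M t)) ->
  variation_bound T mu M -> variation_bound T mu (fun t => invmx (M t)) ->
  variation_bound T kappa A ->
  forall (tau : R) (n : nat), 0 < tau -> tau <= tau0 -> tn tau n <= T ->
  (forall k i, (k < n)%N -> 0 <= tst rk tau k i <= T) ->
  forall (al : nat -> 'cV[R]_N) (st dst : nat -> 'I_s.+1 -> 'cV[R]_N),
  rk_solution rk tau M A B n al st dst ->
  forall (r ta dta : R -> 'cV[R]_N), perturbed_solution M A B T r ta dta ->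
  let e := fun k => al k - ta (tn tau k) in
  let t_ := tst rk tau in
  let Delta := stage_defect rk tau M ta dta in
  let delta := step_defect rk tau M ta dta in
  (qform (M (tn tau n)) (e n)
    + tau * \sum_(1 <= k < n.+1) qform (A (tn tau k)) (e k)
  <= C T *
     (qform (M 0) (e 0%N)
      + tau * (\sum_(0 <= k < n) \sum_(i < s.+1)
                 qform (invmx (A (t_ k i) + M (t_ k i)))
                       (M (t_ k i) *m r (t_ k i)))
      + tau * (\sum_(1 <= k < n.+1)
                 qform (invmx (M (tn tau k))) (tau^-1 *: delta k))
      + tau * (\sum_(0 <= k < n) \sum_(i < s.+1)
                 (qform (M (t_ k i)) (invmx (M (t_ k i)) *m Delta k i)
                  + qform (A (t_ k i)) (invmx (M (t_ k i)) *m Delta k i)))) : Prop).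

Lemma rk_error (R : realType) (s : nat) (rk : rk_method R s) (L mu kappa : R) :
  rk_a rk \in unitmx -> algebraically_stable rk -> stiffly_accurate rk -> 0 <= L ->
  exists tau0 C, 0 < tau0 /\ rk_error_bound rk L mu kappa tau0 C.
Proof.
move=> ua hst hsa L0.
have [tau0 [C [b [[tau00 C0 b0 b1] hstep]]]] := rk_error_step mu kappa ua hst hsa L0.
(* The exponential bounds the Gronwall factor, [1 + C] covers the initial error and the weighted
   defects together, and the inverse of [b <= 1] removes the weight of the dissipation. *)
exists tau0, (fun T => b^-1 * (expR (C * T) * (1 + C))); split=> //.
move=> T N M A B T0 fb tM vM vK vA tau n t0 tt nT tT al st dst hrk r ta dta hp.
move=> e t_ Delta delta.
have hs := hstep T N M A B fb tM vM vK vA tau n t0 tt nT tT al st dst hrk r ta dta hp.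
have tn_in j : (j <= n)%N -> 0 <= tn tau j <= T.
  move=> jn; rewrite /tn mulr_ge0 ?(ltW t0)//=; apply: le_trans nT.
  by rewrite /tn ler_wpM2r ?(ltW t0)// ler_nat.
have M0 t z : 0 <= t <= T -> 0 <= qform (M t) z.
  by move=> /fb fbt; exact: posdef_ge0 (fb_Mpos fbt) z.
have A0 t z : 0 <= t <= T -> 0 <= qform (A t) z.
  by move=> /fb fbt; exact: fb_Age0 fbt z.
pose x k := qform (M (tn tau k)) (e k).
pose y k := qform (A (tn tau k)) (e k).
pose rho k := \sum_(i < s.+1) qform (invmx (A (t_ k i) + M (t_ k i)))
                       (M (t_ k i) *m r (t_ k i)).
(* Shifted by one: the step starting at index [k] carries the defect with index [k + 1]. *)
pose dl k := qform (invmx (M (tn tau k.+1))) (tau^-1 *: delta k.+1).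
pose dD k := \sum_(i < s.+1) (qform (M (t_ k i)) (invmx (M (t_ k i)) *m Delta k i)
                  + qform (A (t_ k i)) (invmx (M (t_ k i)) *m Delta k i)).
have rho0 k : (k < n)%N -> 0 <= rho k.
  by move=> kn; apply: sumr_ge0 => i _; exact: fb_star_ge0 (fb _ (tT k i kn)).
have dD0 k : (k < n)%N -> 0 <= dD k.
  move=> kn; apply: sumr_ge0 => i _.
  by apply: addr_ge0; [apply: M0|apply: A0]; exact: tT.
have dl0 k : (k < n)%N -> 0 <= dl k.
  by move=> /tn_in/fb fbk; exact: posdef_inv_ge0 (fb_Msym fbk) (fb_Mpos fbk) _.
have y0 k : (k < n)%N -> 0 <= y k.+1 by move=> /tn_in; exact: A0.
pose W := \sum_(0 <= k < n) (rho k + dD k + dl k).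
have WE : W = \sum_(0 <= k < n) rho k + \sum_(0 <= k < n) dD k
    + \sum_(0 <= k < n) dl k by rewrite -!big_split.
have sum0 (f : nat -> R) : (forall k, (k < n)%N -> 0 <= f k) ->
    0 <= \sum_(0 <= k < n) f k.
  move=> f0; rewrite big_nat_cond; apply: sumr_ge0 => k /andP[/andP[_ kn] _].
  exact: f0.
have W0 : 0 <= W by rewrite WE !addr_ge0// sum0.
have ct0 : 0 <= C * tau by rewrite mulr_ge0// ltW.
have q1 : 1 <= 1 + C * tau by rewrite lerDl.
have hg : x n + b * tau * \sum_(0 <= k < n) y k.+1
    <= (1 + C * tau) ^+ n * (x 0%N + \sum_(0 <= k < n) (C * tau * (rho k + dD k + dl k))).
  apply: discrete_gronwall => // [k kn|k kn|k kn].
  - by rewrite mulr_ge0// !addr_ge0 ?rho0 ?dD0 ?dl0.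
  - by rewrite mulr_ge0 ?y0// mulr_ge0// ltW.
  - by have := hs k kn; rewrite big_split.
have x00 : 0 <= x 0%N by apply: M0; apply: tn_in.
have -> : qform (M 0) (e 0%N) = x 0%N by rewrite /x /tn mul0r.
rewrite !big_add1/= -/(x n).
rewrite -[X in _ <= _ * X]/(x 0%N + tau * (\sum_(0 <= k < n) rho k)
  + tau * (\sum_(0 <= k < n) dl k) + tau * (\sum_(0 <= k < n) dD k)).
have -> : x 0%N + tau * (\sum_(0 <= k < n) rho k)
  + tau * (\sum_(0 <= k < n) dl k) + tau * (\sum_(0 <= k < n) dD k)
  = x 0%N + tau * W by rewrite WE; ring.
rewrite -mulr_sumr -/W in hg.
have xn0 : 0 <= x n by apply: M0; exact: tn_in.
have tW : 0 <= tau * W by rewrite mulr_ge0// ltW.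
have ty : 0 <= tau * \sum_(0 <= k < n) y k.+1 by rewrite mulr_ge0 ?(ltW t0)// sum0.
rewrite -mulrA -(ler_pM2l b0) mulVKf ?gt_eqF//.
apply: (@le_trans _ _ (x n + b * tau * \sum_(0 <= k < n) y k.+1)).
  by rewrite mulrDr mulrA lerD2r ler_piMl.
apply: le_trans hg _; rewrite -[leRHS]mulrA; apply: ler_pM.
- by rewrite exprn_ge0// addr_ge0.
- by apply: addr_ge0 => //; rewrite mulr_ge0.
- by apply: gronwall_factor_le => //; exact: ltW.
- by have := mulr_ge0 C0 x00; rewrite -mulrA; lra.
Qed.

(** * The estimate for the finite element matrices *)

Theorem lemma4p1 (R : realType) (s q p : nat) (rk : rk_method R s)
    (hq : (1 <= q)%N) (hpq : (q.+1 <= p)%N)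
    (hstage : stage_order rk q) (horder : classical_order rk p)
    (hinv : rk_a rk \in unitmx)
    (hstable : algebraically_stable rk) (hstiff : stiffly_accurate rk)
    (Lambda : R) :
  exists (tau0 : R -> R -> R) (C : R -> R -> R -> R),
    (forall mu kappa, 0 < tau0 mu kappa) /\
    forall (mu kappa T : R), 0 < T ->
    forall (m : nat), (0 < m)%N ->
    forall (Gamma : R -> set 'rV[R]_m.+1)
           (Phi Ale : 'rV[R]_m.+1 * R -> 'rV[R]_m.+1)
           (v w : 'rV[R]_m.+1 -> R -> 'rV[R]_m.+1),
      (forall t : R, 0 <= t <= T -> closed_hypersurface (Gamma t)) ->
      evolution T Gamma Phi v ->
      evolution T Gamma Ale w ->
      (forall (t : R) x, 0 <= t <= T -> Gamma t x -> enorm (w x t - v x t) <= Lambda) ->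
    forall (c h : R), 0 < c ->
    forall (N : nat) (X : connectivity m N) (a : R -> 'I_N -> 'rV[R]_m.+1)
           (chi : 'I_N -> R -> 'rV[R]_m.+1 -> R),
      (forall j, Gamma 0 (a 0 j)) ->
      (forall (t : R) j, 0 <= t <= T -> a t j = Ale (a 0 j, t)) ->
      admissible X T c h a ->
      nodal_basis X T a chi ->
    let M := mass X a chi in
    let A := stiffness X a chi in
    let B := advection X a chi v w in
      variation_bound T mu M ->
      variation_bound T mu (fun t => invmx (M t)) ->
      variation_bound T kappa A ->
    forall (tau : R) (n : nat),
      0 < tau -> tau <= tau0 mu kappa -> tn tau n <= T ->
      (forall k i, (k < n)%N -> 0 <= tst rk tau k i <= T) ->
    forall (al : nat -> 'cV[R]_N) (st dst : nat -> 'I_s.+1 -> 'cV[R]_N),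
      rk_solution rk tau M A B n al st dst ->
    forall (r ta dta : R -> 'cV[R]_N),
      perturbed_solution M A B T r ta dta ->
    let e := fun k => al k - ta (tn tau k) in
    let t_ := tst rk tau in
    let Delta := stage_defect rk tau M ta dta in
    let delta := step_defect rk tau M ta dta in
      qform (M (tn tau n)) (e n)
        + tau * \sum_(1 <= k < n.+1) qform (A (tn tau k)) (e k)
      <= C mu kappa T *
         (qform (M 0) (e 0%N)
          + tau * (\sum_(0 <= k < n) \sum_(i < s.+1)
                     qform (invmx (A (t_ k i) + M (t_ k i)))
                           (M (t_ k i) *m r (t_ k i)))
          + tau * (\sum_(1 <= k < n.+1)
                     qform (invmx (M (tn tau k))) (tau^-1 *: delta k))
          + tau * (\sum_(0 <= k < n) \sum_(i < s.+1)
                     (qform (M (t_ k i)) (invmx (M (t_ k i)) *m Delta k i)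
                      + qform (A (t_ k i)) (invmx (M (t_ k i)) *m Delta k i)))).
Proof.
have L0 : 0 <= Lambda ^+ 2 / 4 by rewrite divr_ge0 ?sqr_ge0.
(* Choice turns the constants for each pair [(mu, kappa)] into functions, before any surface or mesh
   is introduced. *)
have /choice[f hf] : forall mk : R * R, exists tC : R * (R -> R),
    0 < tC.1 /\ rk_error_bound rk (Lambda ^+ 2 / 4) mk.1 mk.2 tC.1 tC.2.
  move=> [mu kappa].
  have [tau0 [C hC]] := rk_error mu kappa hinv hstable hstiff L0.
  by exists (tau0, C).
exists (fun mu kappa => (f (mu, kappa)).1), (fun mu kappa => (f (mu, kappa)).2).
split=> [mu kappa|]; first by case: (hf (mu, kappa)).
move=> mu kappa T T0 m _ Gamma Phi Ale v w _ _ [_ _ hAle _] hvw c h c0 N X a chi.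
move=> ha0 ha hadm hchi M A B vM vK vA tau n t0 tt nT tT al st dst hrk r ta dta hp.
(* The ALE map carries the initial nodes into the surface at time [t], so the velocity bound on the
   surface holds at all nodes. *)
have hL t : 0 <= t <= T -> forall j, enorm (w (a t j) t - v (a t j) t) <= Lambda.
  move=> ht j; apply: hvw => //; rewrite ha//.
  have [[hfun _ _] _ _] := hAle t ht.
  exact: hfun (ha0 j).
have fb t : 0 <= t <= T -> form_bounds (Lambda ^+ 2 / 4) (M t) (A t) (B t).
  move=> ht; split.
  - exact: mass_sym hchi ht.
  - exact: mass_posdef hadm hchi ht.
  - exact: stiffness_sym hchi ht.
  - by move=> z; exact: stiffness_ge0 hchi ht.
  - move=> eps z y eps0.
    have -> : Lambda ^+ 2 / 4 / eps = Lambda ^+ 2 / (4 * eps).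
      by rewrite invfM mulrA.
    exact: advection_bound hchi ht (hL t ht) eps0.
have tM t : 0 <= t <= T -> tensor_ge0 (M t).
  by move=> ht k G Y hG; exact: mass_tensor_ge0 hchi ht hG.
exact: ((hf (mu, kappa)).2 T N M A B T0 fb tM vM vK vA tau n t0 tt nT tT
  al st dst hrk r ta dta hp).
Qed.
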